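(* There exists a constant $C>0$ such that the following holds with $C$ independent of $d$ and $\mathcal T$. Let $\Omega\subset\mathbb R^d$, $d\ge2$, be a bounded polytopal domain, let $\mathcal T$ be a regular, simplicial triangulation of $\Omega$, and let $\mathcal I=\mathcal V$ be its set of vertices, $\mathfrak s(\mathcal I)=\max_{i\in\mathcal I}s(i)$. (i) There exists a NN $\Phi^{CPwL}=\Phi^{CPwL(\mathcal T,\Omega)}$ with only ReLU activations which in parallel emulates the hat functions $\{\theta_i^{\mathrm S^1_1}\}_{i\in\mathcal I}$: $R(\Phi^{CPwL}):\Omega\to\mathbb R^{|\mathcal I|}$ satisfies $R(\Phi^{CPwL})(x)_i=\theta_i^{\mathrm S^1_1}(x)$ for all $x\in\Omega$ and all $i\in\mathcal I$. Moreover $$L(\Phi^{CPwL})\le 8+\log_2(\mathfrak s(\mathcal I))+\log_2(d+1),$$ $$M(\Phi^{CPwL})\le C|\mathcal I|\log_2(\mathfrak s(\mathcal I))+Cd^2\sum_{i\in\mathcal I}s(i)\le Cd^2\,\mathfrak s(\mathcal I)\dim(\mathrm S^1_1(\mathcal T,\Omega)).$$ (ii) For all $v=\sum_{i\in\mathcal I}v_i\theta_i^{\mathrm S^1_1}\in\mathrm S^1_1(\mathcal T,\Omega)$ there exists a NN $\Phi^{CPwL,v}=\Phi^{CPwL(\mathcal T,\Omega),v}$ with only ReLU activations such that $R(\Phi^{CPwL,v})(x)=v(x)$ for all $x\in\Omega$, $$L(\Phi^{CPwL,v})\le 8+\log_2(\mathfrak s(\mathcal I))+\log_2(d+1),$$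 $$M(\Phi^{CPwL,v})\le C|\mathcal I|\log_2(\mathfrak s(\mathcal I))+Cd^2\sum_{i\in\mathcal I}s(i)\le Cd^2\,\mathfrak s(\mathcal I)\dim(\mathrm S^1_1(\mathcal T,\Omega)).$$ (iii) The layer dimensions and the lists of activation functions of $\Phi^{CPwL}$ and $\Phi^{CPwL,v}$ are independent of $v$ and depend on $\mathcal T$ only through $\{s(i)\}_{i\in\mathcal I}$ and $|\mathcal I|=\dim(\mathrm S^1_1(\mathcal T,\Omega))$. (iv) The set $\mathcal{NN}(CPwL;\mathcal T,\Omega):=\{\Phi^{CPwL,v}:v\in\mathrm S^1_1(\mathcal T,\Omega)\}$ together with the linear operation $\Phi^{CPwL,v}\,\widehat+\,\lambda\Phi^{CPwL,w}:=\Phi^{CPwL,v+\lambda w}$ for all $v,w\in\mathrm S^1_1(\mathcal T,\Omega)$ and all $\lambda\in\mathbb R$ is a vector space, and the realization map $R(\cdot):\mathcal{NN}(CPwL;\mathcal T,\Omega)\to\mathrm S^1_1(\mathcal T,\Omega)$ is a linear isomorphism.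
   Context: **Neural networks (NNs).** A NN with input dimension $d$ and depth $L$ is a finite sequence $\Phi=((A_1,b_1,\varrho_1),\dots,(A_L,b_L,\varrho_L))$ where, with $N_0=d$ and $N_1,\dots,N_L\in\mathbb N$ (layer dimensions), $A_\ell\in\mathbb R^{N_\ell\times N_{\ell-1}}$, $b_\ell\in\mathbb R^{N_\ell}$, and $\varrho_\ell$ is a list of $N_\ell$ activation functions $\mathbb R\to\mathbb R$ acting componentwise; $\varrho_L=\mathrm{Id}$. Its realization is $R(\Phi):\mathbb R^d\to\mathbb R^{N_L}$, $x\mapsto x_L$, with $x_0=x$, $x_\ell=\varrho_\ell(A_\ell x_{\ell-1}+b_\ell)$ for $1\le\ell<L$, $x_L=A_Lx_{L-1}+b_L$. Depth: $L(\Phi)=L$. Size: $M(\Phi)=\sum_\ell(\|A_\ell\|_0+\|b_\ell\|_0)$, where $\|\cdot\|_0$ counts nonzero entries. ReLU activation: $\rho(x)=\max\{0,x\}$. **Meshes.** $\mathrm{conv}(Y)=\{\sum_{y\in Y}\lambda_yy:\lambda_y>0,\sum\lambda_y=1\}$ is the open convex hull; a $d$-simplex is $\mathrm{conv}(\{a_0,\dots,a_d\})$ with affinely independent $a_i\in\mathbb R^d$. A regular, simplicial partition (triangulation) $\mathcal T$ of $\Omega$ is a finite set of pairwise disjoint $d$-simplices with $\overline\Omega=\bigcup_{T\in\mathcal T}\overline T$ such that for distinct $T,T'\in\mathcal T$ the set $\overline T\cap\overline{T'}$ is empty or the closure of a common subsimplex. $\mathcal V$ is the set of vertices; $s(p)=|\{T\in\mathcal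 T:p\in\overline T\}|$ for $p\in\mathcal V$. **CPwL functions.** $\mathrm S^1_1(\mathcal T,\Omega)=\{v\in H^1(\Omega):v|_T\in\mathbb P_1\ \forall T\in\mathcal T\}$ (continuous piecewise linear functions; $\mathbb P_1$: polynomials of total degree $\le1$), with basis $\{\theta_p^{\mathrm S^1_1}\}_{p\in\mathcal V}$, where $\theta_p^{\mathrm S^1_1}$ equals $1$ at $p$ and $0$ at all other vertices.
   Formalization: The last bound C d² s(I) dim(S^1_1) gets its own constant C' (also independent of d and T), since with one C the chain fails when all s(i) equal the same s>1; S^1_1 is read as piecewise linear functions continuous up to the boundary of Ω. *)

(* Defs.v *)
From HB Require Import structures.
From mathcomp Require Import all_boot all_order all_algebra finmap.
From mathcomp Require Import all_classical all_reals all_analysis.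

Set Implicit Arguments.
Unset Strict Implicit.
Unset Printing Implicit Defensive.

Import Order.TTheory GRing.Theory Num.Theory.
Import numFieldNormedType.Exports.

Local Open Scope classical_set_scope.
Local Open Scope ring_scope.

Definition log2 {R : realType} (x : R) : R := ln x / ln 2.

(* [nn R m k]: networks with input dimension [m] and output dimension [k].
   [nn_cons A b rho Phi] puts the layer (A, b, rho) in front of [Phi];
   [nn_out A b] is the network whose only layer is (A, b, Id), so that the
   activation of the last layer is the identity by construction.  All layer
   dimensions N_1, ..., N_L are positive. *)
Inductive nn (R : realType) : nat -> nat -> Type :=
| nn_out (m n : nat) of (0 < n)%N & 'M[R]_(n, m) & 'cV[R]_n : nn R m n
| nn_cons (m n k : nat) of (0 < n)%N & 'M[R]_(n, m) & 'cV[R]_n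
    & n.-tuple (R -> R) & nn R n k : nn R m k.

Section NeuralNetworks.
Variable R : realType.

Definition relu (x : R) : R := Num.max 0 x.

Fixpoint realization m k (Phi : nn R m k) : 'cV[R]_m -> 'cV[R]_k :=
  match Phi with
  | nn_out _ _ _ A b => fun x => A *m x + b
  | nn_cons _ _ _ _ A b rho Psi => fun x =>
      realization Psi (\col_i tnth rho i ((A *m x + b) i 0))
  end.

Fixpoint layer_dims m k (Phi : nn R m k) : seq nat :=
  match Phi with
  | nn_out _ n _ _ _ => [:: n]
  | nn_cons _ n _ _ _ _ _ Psi => n :: layer_dims Psi
  end.

Fixpoint activations m k (Phi : nn R m k) : seq (seq (R -> R)) :=
  match Phi with
  | nn_out _ n _ _ _ => [:: nseq n id]
  | nn_cons _ _ _ _ _ _ rho Psi => tval rho :: activations Psi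
  end.

Definition architecture m k (Phi : nn R m k) : seq nat * seq (seq (R -> R)) :=
  (layer_dims Phi, activations Phi).

Definition depth m k (Phi : nn R m k) : nat := size (layer_dims Phi).

Definition norm0 m n (A : 'M[R]_(m, n)) : nat :=
  #|[set ij : 'I_m * 'I_n | A ij.1 ij.2 != 0]%SET|.

Fixpoint nn_size m k (Phi : nn R m k) : nat :=
  match Phi with
  | nn_out _ _ _ A b => (norm0 A + norm0 b)%N
  | nn_cons _ _ _ _ A b _ Psi => (norm0 A + norm0 b + nn_size Psi)%N
  end.

Fixpoint only_relu m k (Phi : nn R m k) : Prop :=
  match Phi with
  | nn_out _ _ _ _ _ => True
  | nn_cons _ _ _ _ _ _ rho Psi =>
      (forall i, tnth rho i = relu) /\ only_relu Psi
  end.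

End NeuralNetworks.

Section Meshes.
Variables (R : realType) (d : nat).
Notation point := 'cV[R]_d.
Implicit Types (Y Z : {fset point}) (S T : set point) (Omega : set point).
Implicit Type TT : {fset set point}.

(* open convex hull: all weights are positive *)
Definition conv Y : set point :=
  [set x | exists l : point -> R,
    [/\ forall y, y \in Y -> 0 < l y,
        \sum_(y <- Y) l y = 1
      & x = \sum_(y <- Y) l y *: y]].

Definition affinely_independent Y : Prop :=
  forall l : point -> R, \sum_(y <- Y) l y = 0 -> \sum_(y <- Y) l y *: y = 0 ->
  forall y, y \in Y -> l y = 0.

Definition simplex_on Y T : Prop := affinely_independent Y /\ T = conv Y.

Definition is_dsimplex T : Prop := exists2 Y, #|` Y| = d.+1 & simplex_on Y T.

Definition subsimplex S T : Prop :=
  exists Y Z, [/\ simplex_on Y T, Z != fset0, (Z `<=` Y)%fset & S = conv Z].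

(* Polytopal: the closure is a finite union of convex polytopes, the hulls of
   the finite sets in [P]. *)
Definition bounded_polytopal_domain Omega : Prop :=
  [/\ open Omega, connected Omega, Omega !=set0, bounded_set Omega
    & exists P : seq {fset point},
        closure Omega = [set x | exists2 Y, Y \in P & closure (conv Y) x]].

Definition regular_triangulation TT Omega : Prop :=
  [/\ forall T, T \in TT -> is_dsimplex T,
      forall T T', T \in TT -> T' \in TT -> T <> T' -> T `&` T' = set0,
      closure Omega = [set x | exists2 T, T \in TT & closure T x]
    & forall T T', T \in TT -> T' \in TT -> T <> T' ->
        closure T `&` closure T' = set0 \/
        exists S, [/\ subsimplex S T, subsimplex S T'
                    & closure T `&` closure T' = closure S]].

Definition vertices TT : set point :=
  [set p | exists T Y, [/\ T \in TT, simplex_on Y T & p \in Y]].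

Definition nb_simplices TT (p : point) : nat :=
  #|` [fset T in TT | p \in closure T]%fset|.

Definition affine_on T (w : point -> R) : Prop :=
  exists (a : 'rV[R]_d) (c : R), forall x, T x -> w x = (a *m x) 0 0 + c.

(* Only the values of [w] on the closure of [Omega] matter. *)
Definition CPwL TT Omega (w : point -> R) : Prop :=
  {within closure Omega, continuous w} /\
  forall T, T \in TT -> affine_on T w.

Definition restr Omega (w : point -> R) : Omega -> R^o := fun x => w (val x).

(* S^1_1(TT, Omega), as a set of functions on Omega.  Its elements are
   evaluated pointwise, so they are taken to be the continuous
   representatives.  Continuity is required up to the boundary, so that
   the values at vertices on the boundary make sense. *)
Definition S11 TT Omega : set (Omega -> R^o) :=
  @restr Omega @` [set w | CPwL TT Omega w].

(* The hat function of [p]: the element of S^1_1 whose continuous extension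
   to the closure of [Omega] is 1 at [p] and 0 at the other vertices (and the
   zero function if there is none). *)
Definition hat TT Omega (p : point) : Omega -> R^o :=
  xget 0 (@restr Omega @`
    [set w | [/\ CPwL TT Omega w, w p = 1
               & forall q, vertices TT q -> q <> p -> w q = 0]]).

End Meshes.

Arguments restr {R d} Omega w _.
Arguments S11 {R d} TT Omega _.
Arguments hat {R d} TT Omega p _.

Section Dimension.
Variables (R : realType) (V : lmodType R).

Definition is_basis (S : set V) n (b : 'I_n -> V) : Prop :=
  (forall i, S (b i)) /\
  forall v, S v -> exists! c : {ffun 'I_n -> R}, v = \sum_(i < n) c i *: b i.

(* 0 if there is no finite basis *)
Definition subspace_dim (S : set V) : nat :=
  xget 0%N [set n | exists b : 'I_n -> V, is_basis S b].

End Dimension.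

(* Main.v *)
Require Import Defs.
From HB Require Import structures.
From mathcomp Require Import all_boot all_order all_algebra finmap.
From mathcomp Require Import all_classical all_reals all_analysis.
From mathcomp Require Import unstable zify ring lra.

Set Implicit Arguments.
Unset Strict Implicit.
Unset Printing Implicit Defensive.

Import Order.TTheory GRing.Theory Num.Theory.
Import numFieldNormedType.Exports.

Local Open Scope classical_set_scope.
Local Open Scope ring_scope.

(** Why the theorem holds.  Let [T] be a simplex with vertex [p], let
  [b T q] be its barycentric coordinates, extended to affine functions on the
  whole space, and for a slope [N] let the tent of [T] at [p] be the minimum
  of [b T p] and of [b T p + N * b T q] over the other vertices [q] of [T].
  On [T] the tent is [b T p], because there all coordinates are nonnegative.
  Outside [T] some coordinate is negative, and if [N] is large the tent drops
  below the hat function of [p] on all the other simplices of the mesh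
  ([tent_below_hat]).  Hence on the closure of the domain
    [hat p x = max_T relu (min_q (b T p x + [q <> p] N b T q x))],
  where [T] ranges over the simplices around [p].  The patch around [p]
  may be nonconvex.  The formula is continuous and affine on each simplex,
  so it also shows that hat functions exist ([tent_hat], [hat_tent]).

  The slope comes from compactness.  Let [T'] be another simplex and [F] the
  common face.  A point of the face of [T'] opposite to [F] with all
  coordinates [b T q], [q] not in [F], nonnegative could be moved towards [F]
  into the intersection of the closed simplices, away from [F]
  ([opposite_face_negative]).  So on that compact face the most negative of
  these coordinates is bounded away from zero ([opposite_face_separation]), and
  by homogeneity it decreases at least linearly in the distance to [F], whereas
  the difference of [b T p] and the hat function vanishes on [F] and grows at
  most linearly.

  Since relu is monotone it commutes with minima, so the network first
  computes all [relu] of the affine forms and then compares nonnegative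
  numbers only: [min a b = relu a - relu (a - b)] and
  [max a b = relu a + relu (b - a)].  The linear part of such a comparison is
  merged into the weights of the next layer, whose rows have at most four
  nonzero entries, so one level of comparisons costs one layer.  Binary tournaments find the
  minimum of [d + 1] numbers in [log2 (d + 1)] levels, rounded up, and then the
  maximum of [s i] numbers in [log2 (max s)] levels.  A group that is down to
  one number passes it on, which costs a bounded number of entries per level
  and explains the term [n * log2 (max s)] of the size; the first layer
  consists of [d + 1] affine forms in [d] variables for each pair of a vertex
  and a simplex around it, whence the term [d ^ 2 * sum s].  All layer
  dimensions are sums over the vertices of contributions that depend on [d] and [s i] only, so
  that the architecture is a function of [d], [n] and the multiset of the
  [s i].

  A function of the finite element space is the combination of the hat
  functions with its vertex values as coefficients; these enter the last layer
  only.  Finally, realization is injective on the networks so obtained, and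
  their vector space structure is that of the function space carried over
  along it ([network_space]). *)

(** * Min-max circuits *)

Section Circuits.
Variable R : realType.

(** Layered comparator circuits.  The wires of a layer are indexed by an
  arbitrary finite type, so that circuits running in parallel for all vertices
  form one circuit over a dependent sum.  The output wire [j] of [gates]
  compares the wires [e j] and [i] if [o j = Some i], and copies [e j] if
  [o j = None].  [rewire] and [output] merely select wires and become row
  selections of a weight matrix. *)
Inductive circuit : finType -> finType -> Type :=
| output (I K : finType) (f : K -> I) : circuit I K
| rewire (I J K : finType) (f : J -> I) of circuit J K : circuit I K
| gates (I J K : finType) (j0 : J) (is_max : bool) (e : J -> I)
    (o : J -> option I) of circuit J K : circuit I K.

Definition gate (is_max : bool) (a b : R) : R :=
  if is_max then Num.max a b else Num.min a b.

Definition gates_run (I J : finType) is_max (e : J -> I) (o : J -> option I)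
    (x : I -> R) (j : J) : R :=
  if o j is Some i then gate is_max (x (e j)) (x i) else x (e j).

Fixpoint run I K (c : circuit I K) : (I -> R) -> K -> R :=
  match c with
  | output _ _ f => fun x => x \o f
  | rewire _ _ _ f c' => fun x => run c' (x \o f)
  | gates _ _ _ _ is_max e o c' => fun x => run c' (gates_run is_max e o x)
  end.

Fixpoint cascade I J (c : circuit I J) : forall K, circuit J K -> circuit I K :=
  match c with
  | output _ _ f => fun K c2 => rewire f c2
  | rewire _ _ _ f c' => fun K c2 => rewire f (cascade c' c2)
  | gates _ _ _ j0 b e o c' => fun K c2 => gates j0 b e o (cascade c' c2)
  end.

Fixpoint widths I K (c : circuit I K) : seq nat :=
  match c with
  | output _ _ _ => [::]
  | rewire _ _ _ _ c' => widths c'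
  | gates _ J _ _ _ _ _ c' => #|J| :: widths c'
  end.

Lemma run_cascade I J K (c : circuit I J) (c2 : circuit J K) x :
  run (cascade c c2) x = run c2 (run c x).
Proof. by elim: c K c2 x => //= *. Qed.

Lemma widths_cascade I J K (c : circuit I J) (c2 : circuit J K) :
  widths (cascade c c2) = widths c ++ widths c2.
Proof. by elim: c K c2 => //= I' J' K' _ _ _ _ c' IH K c2; rewrite IH. Qed.

Lemma gates_run_ge0 (I J : finType) is_max (e : J -> I) o (x : I -> R) :
  (forall i, 0 <= x i) -> forall j, 0 <= gates_run is_max e o x j.
Proof.
move=> x0 j; rewrite /gates_run /gate; case: (o j) => [i|//].
by case: is_max; rewrite ?le_max ?le_min !x0.
Qed.

Lemma run_continuous (T : topologicalType) I K (c : circuit I K)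
    (x : T -> I -> R) :
  (forall i, continuous (fun t => x t i : R^o)) ->
  forall k, continuous (fun t => run c (x t) k : R^o).
Proof.
elim: c x => [I' K' f|I' J K' f c' IH|I' J K' _ b e o c' IH] x xc k /=.
- exact: xc.
- by apply: IH => j; exact: xc.
- apply: IH => j t; rewrite /gates_run /gate.
  case: (o j) => [i|]; last exact: xc.
  case: b.
    by apply: (@continuous_max _ _ (fun t => x t (e j)) (fun t => x t i)); exact: xc.
  by apply: (@continuous_min _ _ (fun t => x t (e j)) (fun t => x t i)); exact: xc.
Qed.

(** ** Compilation into ReLU networks *)

Definition vec (I : finType) (x : I -> R) : 'cV[R]_#|I| :=
  \col_a x (enum_val a).

Definition mat (J I : finType) (W : J -> I -> R) : 'M[R]_(#|J|, #|I|) :=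
  \matrix_(a, b) W (enum_val a) (enum_val b).

Lemma mulmx_enum_vec m (I : finType) (W : 'I_m -> I -> R) x r k :
  ((\matrix_(a, b) W a (enum_val b)) *m vec x) r k = \sum_i W r i * x i.
Proof.
rewrite !mxE [RHS](reindex (@enum_val _ (mem I))) /=.
  by apply: eq_bigr => i _; rewrite !mxE.
by apply: onW_bij; exact: enum_val_bij.
Qed.

Lemma mulmx_vec (J I : finType) (W : J -> I -> R) x :
  mat W *m vec x = vec (fun j => \sum_i W j i * x i).
Proof.
apply/matrixP => a b; rewrite [RHS]mxE.
exact: (mulmx_enum_vec (fun a => W (enum_val a))).
Qed.

(** The two comparisons differ in this sign only, see [gate_relu]. *)
Definition gate_sign (is_max : bool) : R := if is_max then -1 else 1.

(** Weights of the two neurons that serve one gate; the second one is idle if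
  the gate copies its input. *)
Definition gate_in (I J : finType) is_max (e : J -> I) (o : J -> option I)
    (h : J + J) (i : I) : R :=
  match h with
  | inl j => (i == e j)%:R
  | inr j => if o j is Some i' then
      gate_sign is_max * ((i == e j)%:R - (i == i')%:R) else 0
  end.

(** Weights that read the result of a gate off its two neurons. *)
Definition gate_out (J : finType) is_max (j : J) (h : J + J) : R :=
  (h == inl j)%:R - gate_sign is_max * (h == inr j)%:R.

Lemma sum_delta (I : finType) (i0 : I) (x : I -> R) :
  \sum_i (i == i0)%:R * x i = x i0.
Proof.
rewrite (bigD1 i0) //= eqxx mul1r big1 ?addr0 // => i /negPf ->.
by rewrite mul0r.
Qed.

Lemma gate_inE (I J : finType) is_max (e : J -> I) o (x : I -> R) h :
  \sum_i gate_in is_max e o h i * x i =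
  match h with
  | inl j => x (e j)
  | inr j => if o j is Some i' then gate_sign is_max * (x (e j) - x i') else 0
  end.
Proof.
case: h => j /=; first exact: sum_delta.
case: (o j) => [i'|]; last by rewrite big1 // => i _; rewrite mul0r.
under eq_bigr do rewrite -mulrA mulrBl.
by rewrite -mulr_sumr sumrB !sum_delta.
Qed.

Lemma gate_outE (J : finType) is_max j (y : J + J -> R) :
  \sum_h gate_out is_max j h * y h =
  y (inl j) - gate_sign is_max * y (inr j).
Proof.
rewrite /gate_out; under eq_bigr do rewrite mulrBl -mulrA.
by rewrite sumrB -mulr_sumr !sum_delta.
Qed.

(** The outcome is linear in the two neurons, so that the next layer can take
  it in without a layer in between. *)
Lemma gate_relu is_max (a b : R) : 0 <= a ->
  relu a - gate_sign is_max * relu (gate_sign is_max * (a - b)) =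
  gate is_max a b.
Proof.
move=> a0; rewrite /relu /gate /gate_sign (max_r a0).
by case: is_max; case: (leP a b) => ab;
  rewrite ?mulN1r ?mul1r ?opprK;
  [rewrite max_r|rewrite max_l|rewrite max_l|rewrite max_r]; lra.
Qed.

Lemma card_sum_gt0 (J : finType) : J -> (0 < #|{: J + J}|)%N.
Proof. by move=> j0; apply/card_gt0P; exists (inl j0). Qed.

(** [A] maps the neurons of the preceding layer linearly to the wires of the
  circuit; a gate layer multiplies it into its own weights and hands its
  [gate_out] on.  [B] is applied to the final wires. *)
Fixpoint compile I K (c : circuit I K) :
    forall m q, (0 < q)%N -> 'M[R]_(#|I|, m) -> 'M[R]_(q, #|K|) -> nn R m q :=
  match c with
  | output _ _ f => fun m q q0 A B =>
      nn_out q0 (B *m mxsub (fun a => enum_rank (f (enum_val a))) id A) 0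
  | rewire _ _ _ f c' => fun m q q0 A B =>
      compile c' q0 (mxsub (fun a => enum_rank (f (enum_val a))) id A) B
  | gates _ J _ j0 is_max e o c' => fun m q q0 A B =>
      nn_cons (card_sum_gt0 j0) (mat (gate_in is_max e o) *m A) 0
        [tuple of nseq #|{: J + J}| (@relu R)]
        (compile c' q0 (mat (gate_out is_max)) B)
  end.

Lemma relu_layer m (I : finType) (x : I -> R) (A : 'M[R]_(#|I|, m)) b u :
  A *m u + b = vec x ->
  \col_i tnth [tuple of nseq #|I| (@relu R)] i ((A *m u + b) i 0) =
  vec (fun i => relu (x i)).
Proof.
by move=> ->; apply/matrixP => i j; rewrite !mxE tnth_nseq.
Qed.

Lemma rowsub_vec (I K : finType) (f : K -> I) m (A : 'M[R]_(#|I|, m)) u x :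
  A *m u = vec x ->
  mxsub (fun a => enum_rank (f (enum_val a))) id A *m u = vec (x \o f).
Proof.
move=> /matrixP Au; apply/matrixP => a b; rewrite !mxE /=.
have := Au (enum_rank (f (enum_val a))) b; rewrite !mxE enum_rankK => <-.
by apply: eq_bigr => i _; rewrite !mxE.
Qed.

Lemma realization_compile I K (c : circuit I K) m q (q0 : (0 < q)%N)
    (A : 'M[R]_(#|I|, m)) (B : 'M[R]_(q, #|K|)) u x :
  (forall i, 0 <= x i) -> A *m u = vec x ->
  realization (compile c q0 A B) u = B *m vec (run c x).
Proof.
elim: c m q q0 A B u x
  => [I' K' f|I' J K' f c' IH|I' J K' j0 b e o c' IH] m q q0 A B u x x0 Au /=.
- by rewrite addr0 -mulmxA; congr (_ *m _); exact: rowsub_vec.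
- by apply: IH => [j|]; [exact: x0|exact: rowsub_vec].
- rewrite (@relu_layer _ _ (fun h => \sum_i gate_in b e o h i * x i)).
    apply: IH => [j|]; first exact: gates_run_ge0.
    rewrite mulmx_vec; congr vec; apply/funext => j.
    rewrite gate_outE !gate_inE /gates_run.
    case: (o j) => [i|]; first by rewrite gate_relu.
    by rewrite /relu maxxx mulr0 subr0 max_r.
  by rewrite addr0 -mulmxA Au mulmx_vec.
Qed.

Lemma layer_dims_compile I K (c : circuit I K) m q (q0 : (0 < q)%N)
    (A : 'M[R]_(#|I|, m)) (B : 'M[R]_(q, #|K|)) :
  layer_dims (compile c q0 A B) = rcons [seq w.*2 | w <- widths c] q.
Proof.
elim: c m q q0 A B
  => [I' K' f|I' J K' f c' IH|I' J K' j0 b e o c' IH] m q q0 A B //=.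
by rewrite IH card_sum addnn.
Qed.

Lemma activations_compile I K (c : circuit I K) m q (q0 : (0 < q)%N)
    (A : 'M[R]_(#|I|, m)) (B : 'M[R]_(q, #|K|)) :
  activations (compile c q0 A B) =
  rcons [seq nseq w.*2 (@relu R) | w <- widths c] (nseq q id).
Proof.
elim: c m q q0 A B
  => [I' K' f|I' J K' f c' IH|I' J K' j0 b e o c' IH] m q q0 A B //=.
by rewrite IH card_sum addnn.
Qed.

Lemma only_relu_compile I K (c : circuit I K) m q (q0 : (0 < q)%N)
    (A : 'M[R]_(#|I|, m)) (B : 'M[R]_(q, #|K|)) :
  only_relu (compile c q0 A B).
Proof.
elim: c m q q0 A B
  => [I' K' f|I' J K' f c' IH|I' J K' j0 b e o c' IH] m q q0 A B //=.
by split=> // i; rewrite tnth_nseq.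
Qed.

(** ** Sparsity *)

Definition row_sparse m n (r : nat) (A : 'M[R]_(m, n)) :=
  forall i, (#|[set j | A i j != 0%R]%SET| <= r)%N.

Lemma norm0_sum m n (A : 'M[R]_(m, n)) :
  norm0 A = (\sum_i #|[set j | A i j != 0%R]%SET|)%N.
Proof.
rewrite /norm0 -sum1_card.
under [RHS]eq_bigr do rewrite -sum1_card.
rewrite pair_big_dep /=; apply: eq_bigl => -[i j].
by rewrite !inE.
Qed.

Lemma norm0_row_sparse m n r (A : 'M[R]_(m, n)) :
  row_sparse r A -> (norm0 A <= m * r)%N.
Proof.
move=> Ar; rewrite norm0_sum; apply: (@leq_trans (\sum_(i < m) r)%N).
  exact: leq_sum.
by rewrite sum_nat_const card_ord.
Qed.

Lemma norm0_le_mul m n (A : 'M[R]_(m, n)) : (norm0 A <= m * n)%N.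
Proof.
by apply: norm0_row_sparse => r; rewrite -[leqRHS]card_ord max_card.
Qed.

(** Row [i] of the product is supported in the union of the supports of the
  rows [k] of [A] with [B i k != 0]. *)
Lemma norm0_mulmx m n l r (B : 'M[R]_(m, n)) (A : 'M[R]_(n, l)) :
  row_sparse r A -> (norm0 (B *m A) <= norm0 B * r)%N.
Proof.
move=> Ar; rewrite !norm0_sum big_distrl /=; apply: leq_sum => i _.
have sub : ([set j | (B *m A) i j != 0] \subset
    \bigcup_(k in [set k | B i k != 0]%SET) [set j | A k j != 0])%SET.
  apply/fintype.subsetP => j; rewrite inE mxE => nz.
  have [k /andP[Bk Ak]] : exists k, (B i k != 0) && (A k j != 0).
    apply/existsP; apply: contraNT nz; rewrite negb_exists => /forallP h.
    rewrite big1 // => k _; apply/eqP; rewrite mulf_eq0.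
    by have := h k; rewrite negb_and !negbK.
  by apply/finset.bigcupP; exists k; rewrite inE.
apply: leq_trans (subset_leq_card sub) _.
apply: leq_trans (card_big_setU _ _ _) _; rewrite -sum_nat_const.
by apply: leq_sum => k _; exact: Ar.
Qed.

Lemma row_sparse_mxsub m n l r (f : 'I_l -> 'I_m) (A : 'M[R]_(m, n)) :
  row_sparse r A -> row_sparse r (mxsub f id A).
Proof.
move=> Ar i; apply: leq_trans (Ar (f i)).
by apply: subset_leq_card; apply/fintype.subsetP => j; rewrite !inE mxE.
Qed.

Lemma row_sparse_mat (J I : finType) (W : J -> I -> R) r :
  (forall j, #|[set i | W j i != 0%R]%SET| <= r)%N -> row_sparse r (mat W).
Proof.
move=> Wr a; apply: leq_trans (Wr (enum_val a)).
rewrite -(card_imset _ (@enum_val_inj _ (mem I))) subset_leq_card //.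
by apply/fintype.subsetP => i /imsetP[b]; rewrite !inE mxE => nz ->.
Qed.

Lemma gate_in_sparse (I J : finType) is_max (e : J -> I) o :
  row_sparse 2 (mat (gate_in is_max e o)).
Proof.
apply: row_sparse_mat => -[j|j] /=.
  apply: leq_trans (_ : #|[set e j]%SET| <= 2)%N; last by rewrite cards1.
  apply: subset_leq_card; apply/fintype.subsetP => i; rewrite !inE.
  by apply: contraR => /negPf ->.
case: (o j) => [i'|]; last first.
  by rewrite (_ : finset _ = finset.set0) ?cards0 //;
    apply/finset.setP => i; rewrite !inE eqxx.
apply: leq_trans (_ : #|[set e j; i']%SET| <= 2)%N.
  apply: subset_leq_card; apply/fintype.subsetP => i; rewrite !inE.
  by apply: contraR; rewrite negb_or => /andP[/negPf -> /negPf ->];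
    rewrite subrr mulr0.
by rewrite cards2; case: (_ != _).
Qed.

Lemma gate_out_sparse (J : finType) is_max :
  row_sparse 2 (mat (@gate_out J is_max)).
Proof.
apply: row_sparse_mat => j.
apply: leq_trans (_ : #|[set inl j; inr j : J + J]%SET| <= 2)%N.
  apply: subset_leq_card; apply/fintype.subsetP => i; rewrite !inE /gate_out.
  by apply: contraR; rewrite negb_or => /andP[/negPf -> /negPf ->];
    rewrite mulr0 subrr.
by rewrite cards2; case: (_ != _).
Qed.

Lemma norm0_0 m n : norm0 (0 : 'M[R]_(m, n)) = 0%N.
Proof.
by apply/eqP; rewrite cards_eq0; apply/eqP/finset.setP => ij;
  rewrite !inE mxE eqxx.
Qed.

(** A gate has two neurons, and each of them has at most two inputs, which are
  outcomes of gates of the layer before and have two neurons each. *)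
Lemma size_compile I K (c : circuit I K) m q (q0 : (0 < q)%N)
    (A : 'M[R]_(#|I|, m)) (B : 'M[R]_(q, #|K|)) :
  row_sparse 2 A ->
  (nn_size (compile c q0 A B) <= 8 * sumn (widths c) + 2 * norm0 B)%N.
Proof.
elim: c m q q0 A B
  => [I' K' f|I' J K' f c' IH|I' J K' j0 b e o c' IH] m q q0 A B A2 /=.
- rewrite norm0_0 addn0 muln0 add0n mulnC; apply: norm0_mulmx.
  exact: row_sparse_mxsub.
- by apply: IH; exact: row_sparse_mxsub.
- rewrite norm0_0 addn0.
  have h1 := norm0_mulmx (mat (gate_in b e o)) A2.
  have h2 : (norm0 (mat (gate_in b e o)) <= 4 * #|J|)%N.
    apply: leq_trans (norm0_row_sparse (@gate_in_sparse _ _ b e o)) _.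
    by rewrite card_sum; lia.
  have h3 := IH _ _ q0 _ B (@gate_out_sparse J b).
  rewrite mulnDr -addnA; apply: leq_add h3.
  by apply: leq_trans h1 _; rewrite -[8%N]/(4 * 2)%N mulnAC leq_mul2r h2 orbT.
Qed.

(** ** Tournament trees *)

Lemma uphalf_gt0 l : (0 < l)%N -> (0 < uphalf l)%N.
Proof. by case: l => [//|l]; rewrite /= ltnS. Qed.

Lemma double_ltn l (m : 'I_(uphalf l)) : (m.*2 < l)%N.
Proof. by case: m => m /=; lia. Qed.

Definition pair_fst (K : finType) (l : K -> nat)
    (t : {k : K & 'I_(uphalf (l k))}) : {k : K & 'I_(l k)} :=
  Tagged (fun k => 'I_(l k)) (Ordinal (double_ltn (tagged t))).

Definition pair_snd (K : finType) (l : K -> nat)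
    (t : {k : K & 'I_(uphalf (l k))}) : option {k : K & 'I_(l k)} :=
  omap (@Tagged _ (tag t) (fun k => 'I_(l k))) (insub (tagged t).*2.+1).

(** Each round halves all groups [l k] at once.  Groups that are down to one
  wire stay as they are, so groups of different sizes may share the number [j]
  of rounds; the wire read off at the end is the only one left as soon as
  [l k <= 2 ^ j]. *)
Fixpoint tournament is_max j (K : finType) (k0 : K) (l : K -> nat)
    (l0 : forall k, (0 < l k)%N) {struct j} : circuit {k : K & 'I_(l k)} K :=
  match j with
  | 0 => output (fun k => Tagged (fun k => 'I_(l k)) (Ordinal (l0 k)))
  | j'.+1 =>
    @gates _ {k : K & 'I_(uphalf (l k))} _
      (Tagged (fun k => 'I_(uphalf (l k))) (Ordinal (uphalf_gt0 (l0 k0))))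
      is_max (@pair_fst K l) (@pair_snd K l)
      (tournament is_max j' k0 (fun k => uphalf_gt0 (l0 k)))
  end.

Definition beats (is_max : bool) (a b : R) :=
  if is_max then b <= a else a <= b.

Lemma beats_trans is_max a b c :
  beats is_max a b -> beats is_max b c -> beats is_max a c.
Proof. by case: is_max => /= h1 h2; lra. Qed.

Lemma beats_refl is_max a : beats is_max a a.
Proof. by case: is_max => /=. Qed.

Lemma gateP is_max a b :
  [/\ beats is_max (gate is_max a b) a, beats is_max (gate is_max a b) b
    & gate is_max a b = a \/ gate is_max a b = b].
Proof.
by rewrite /gate /beats; case: is_max; case: (leP a b) => ab; split=> //;
  first [exact: ltW | by left | by right].
Qed.

Lemma tournamentP is_max j (K : finType) (k0 : K) (l : K -> nat)
    (l0 : forall k, (0 < l k)%N) (x : {k : K & 'I_(l k)} -> R) k :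
  (forall k, l k <= 2 ^ j)%N ->
  let y := run (tournament is_max j k0 l0) x k in
  (exists i : 'I_(l k), y = x (Tagged _ i)) /\
  forall i : 'I_(l k), beats is_max y (x (Tagged _ i)).
Proof.
elim: j l l0 x => [|j IH] l l0 x lj /=.
  split=> [|i]; first by exists (Ordinal (l0 k)).
  have -> : i = Ordinal (l0 k).
    by apply: val_inj; have := lj k; rewrite expn0; case: i => i /=; lia.
  exact: beats_refl.
set x' := gates_run _ _ _ x.
have [|[i yE] ybeats] := IH _ (fun k => uphalf_gt0 (l0 k)) x'.
  by move=> k'; have := lj k'; rewrite expnS; lia.
set y := run _ _ _ in yE ybeats *; split.
  rewrite yE /x' /gates_run /pair_snd /=; case: insubP => [i' _ _|_] /=.
    set a := x (pair_fst _); set b := x (Tagged (fun k => 'I_(l k)) i').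
    by have [_ _ [->|->]] := gateP is_max a b; eexists.
  by eexists.
move=> i'; have i'2 : ((i' : nat)./2 < uphalf (l k))%N.
  by case: i' => /= i'; lia.
pose t := Tagged (fun k => 'I_(uphalf (l k))) (Ordinal i'2).
apply: beats_trans (ybeats (Ordinal i'2)) _; rewrite -/t.
have fstE : ~~ odd i' -> Tagged (fun k => 'I_(l k)) i' = pair_fst t.
  by move=> ei'; congr Tagged; apply: val_inj => /=; lia.
rewrite /x' /gates_run /pair_snd /=; case: insubP => [i2 _ i2E|] /=.
  have [b1 b2 _] := gateP is_max (x (pair_fst t)) (x (Tagged (fun k => 'I_(l k)) i2)).
  have [oi|/fstE -> //] := boolP (odd i').
  by have -> : i' = i2 by apply: val_inj; rewrite /= i2E /=; lia.
rewrite -leqNgt => le2; rewrite -fstE; last by case: i' le2 {i'2 t fstE} => /= i'; lia.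
exact: beats_refl.
Qed.

Lemma widths_tournament is_max j (K : finType) (k0 : K) (l : K -> nat)
    (l0 : forall k, (0 < l k)%N) :
  widths (tournament is_max j k0 l0) =
  [seq (\sum_k iter i uphalf (l k))%N | i <- iota 1 j].
Proof.
elim: j l l0 => [|j IH] l l0 //=; rewrite IH card_tagged sumnE big_map big_enum.
congr (_ :: _); first by apply: eq_bigr => k _; rewrite card_ord.
rewrite -[2%N]/(1 + 1)%N iotaDl -map_comp; apply: eq_map => i /=.
by apply: eq_bigr => k _; rewrite -iterSr.
Qed.

(** The sequence [uphalf^i l - 1] at least halves in each step; the summand [j]
  accounts for the wire that remains in every round. *)
Lemma sumn_halving j l : (0 < l)%N ->
  (\sum_(i <- iota 1 j) iter i uphalf l <= l + j)%N.
Proof.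
elim: j l => [|j IH] l l0; first by rewrite big_nil.
rewrite /= big_cons -[2%N]/(1 + 1)%N iotaDl big_map.
under eq_bigr do rewrite add1n iterSr.
by have := IH _ (uphalf_gt0 l0) => /=; lia.
Qed.

Lemma sumn_widths_tournament is_max j (K : finType) (k0 : K) (l : K -> nat)
    (l0 : forall k, (0 < l k)%N) :
  (sumn (widths (tournament is_max j k0 l0)) <= \sum_k l k + #|K| * j)%N.
Proof.
rewrite widths_tournament sumnE big_map exchange_big /= -sum_nat_const.
by rewrite -big_split /=; apply: leq_sum => k _; exact: sumn_halving.
Qed.

End Circuits.

(** * Max-min networks *)

(** The arithmetic of the size: [S] is the sum of the [s i], [w] the number of
  gates, and [xA], [xb], [xB] and [xc] count the entries of the first matrix,
  of its bias, of the output matrix and of the compiled circuit. *)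
Lemma entry_count_bound (S xA xb xB xc w kd ks n d : nat) :
  (xA <= S * d.+1 * d -> xb <= S * d.+1 -> xc <= 8 * w + 2 * xB ->
   w <= S * d.+1 + S * kd + (S + n * ks) -> kd <= d.+1 -> n <= S -> xB <= n ->
   xA + xb + xc <= S * (d.+1 ^ 2 + 16 * d.+1 + 10) + 8 * n * ks)%N.
Proof.
move=> hA hb hc hw hd nS Bn.
have : (S * kd <= S * d.+1)%N by rewrite leq_mul2l hd orbT.
by rewrite expnS expn1; nia.
Qed.

Section MaxMinNetwork.
Variable R : realType.

(** Two neurons for each gate.  The sum and the maximum over [ms] do not see
  the order of the entries, so the dimensions depend on their multiset. *)
Definition hidden_dims (d : nat) (ms : seq nat) : seq nat :=
  (sumn ms * d.+1)%N ::
  [seq w.*2 | w <-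
    [seq (sumn ms * iter l uphalf d.+1)%N | l <- iota 1 (up_log 2 d.+1)] ++
    [seq (\sum_(m <- ms) iter l uphalf m)%N
      | l <- iota 1 (up_log 2 (\max_(m <- ms) m))]].

Definition relu_architecture (hidden : seq nat) (q : nat) :
    seq nat * seq (seq (R -> R)) :=
  (rcons hidden q, rcons [seq nseq w (@relu R) | w <- hidden] (nseq q id)).

Lemma perm_hidden_dims d ms ms' : perm_eq ms ms' ->
  hidden_dims d ms = hidden_dims d ms'.
Proof.
move=> P; rewrite /hidden_dims (perm_sumn P) (perm_big _ P) /=.
congr (_ :: map _ (_ ++ _)).
by apply: eq_map => l; rewrite (perm_big _ P).
Qed.

Variables (n d : nat) (s : 'I_n -> nat).
Variables (i0 : 'I_n) (s_gt0 : forall i, (0 < s i)%N).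

(** A vertex [i] together with one of the [s i] simplices around it. *)
Definition branch : finType := {i : 'I_n & 'I_(s i)}.
Definition form_index : finType := {k : branch & 'I_d.+1}.

Definition branch0 : branch := Tagged (fun i => 'I_(s i)) (Ordinal (s_gt0 i0)).

Definition smax : nat := \max_(i < n) s i.

Definition maxmin_circuit : circuit form_index 'I_n :=
  cascade
    (@tournament false (up_log 2 d.+1) branch branch0 (fun=> d.+1)
      (fun=> ltn0Sn d))
    (@tournament true (up_log 2 smax) 'I_n i0 s s_gt0).

Definition form_of i (k : 'I_(s i)) (j : 'I_d.+1) : form_index :=
  @Tagged branch (Tagged (fun i => 'I_(s i)) k) (fun=> 'I_d.+1) j.

Lemma maxmin_circuitP (y : form_index -> R) i :
  let v := run maxmin_circuit y i in
  exists m : 'I_(s i) -> R,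
    [/\ forall k, (exists j, m k = y (form_of k j)) /\
                  forall j, m k <= y (form_of k j),
        exists k, v = m k & forall k, m k <= v].
Proof.
move=> v; rewrite /v /maxmin_circuit run_cascade; set mins := run _ y.
have smaxP i' : (s i' <= 2 ^ up_log 2 smax)%N.
  by apply: (leq_trans _ (up_logP smax _)) => //; exact: leq_bigmax.
have [[k vE] v_max] := @tournamentP R true _ _ i0 s s_gt0 mins i smaxP.
exists (fun k => mins (Tagged (fun i => 'I_(s i)) k)); split.
- move=> k'; have dP : branch -> (d.+1 <= 2 ^ up_log 2 d.+1)%N.
    by move=> _; exact: up_logP.
  by have [[j jE] mj] := @tournamentP R false _ _ branch0 (fun=> d.+1) (fun=> ltn0Sn d) y
       (Tagged (fun i => 'I_(s i)) k') dP; split; [exists j|].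
- by exists k.
- by move=> k'; exact: v_max.
Qed.

Lemma maxmin_circuit_continuous (T : topologicalType)
    (y : T -> form_index -> R) :
  (forall t, continuous (fun x => y x t : R^o)) ->
  forall i, continuous (fun x => run maxmin_circuit (y x) i : R^o).
Proof. exact: run_continuous. Qed.

Let ms : seq nat := [seq s i | i <- enum 'I_n].

Lemma card_branch : #|branch| = sumn ms.
Proof.
rewrite card_tagged !sumnE !big_map; apply: eq_bigr => i _.
by rewrite card_ord.
Qed.

Lemma card_form_index : #|form_index| = (sumn ms * d.+1)%N.
Proof.
rewrite card_tagged sumnE big_map big_enum /= -card_branch.
by under eq_bigr do rewrite card_ord; rewrite sum_nat_const.
Qed.

Lemma widths_maxmin : widths maxmin_circuit =
  [seq (sumn ms * iter l uphalf d.+1)%N | l <- iota 1 (up_log 2 d.+1)] ++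
  [seq (\sum_(m <- ms) iter l uphalf m)%N
    | l <- iota 1 (up_log 2 (\max_(m <- ms) m))].
Proof.
rewrite widths_cascade !widths_tournament; congr (_ ++ _).
  by apply: eq_map => l; rewrite sum_nat_const card_branch.
have -> : \max_(m <- ms) m = smax by rewrite big_map big_enum.
by apply: eq_map => l; rewrite big_map big_enum.
Qed.

Lemma form_index_gt0 : (0 < #|form_index|)%N.
Proof.
apply/card_gt0P; exists (@Tagged branch branch0 (fun=> 'I_d.+1) ord0) => //.
Qed.

Variables (a : form_index -> 'rV[R]_d) (c : form_index -> R).

Definition maxmin (x : 'cV[R]_d) : 'I_n -> R :=
  run maxmin_circuit (fun t => relu ((a t *m x) 0 0 + c t)).

Definition form_mx : 'M[R]_(#|form_index|, d) := \matrix_r a (enum_val r).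

Definition maxmin_net q (q0 : (0 < q)%N) (B : 'M[R]_(q, #|'I_n|)) : nn R d q :=
  nn_cons form_index_gt0 form_mx (vec c)
    [tuple of nseq #|form_index| (@relu R)]
    (compile maxmin_circuit q0 1%:M B).

Section Properties.
Variables (q : nat) (q0 : (0 < q)%N) (B : 'M[R]_(q, #|'I_n|)).

Lemma realization_maxmin_net x :
  realization (maxmin_net q0 B) x = B *m vec (maxmin x).
Proof.
rewrite /= (@relu_layer _ _ _ (fun t => (a t *m x) 0 0 + c t)).
  apply: realization_compile; last by rewrite mul1mx.
  by move=> t; rewrite le_max lexx.
apply/matrixP => r k; rewrite !mxE; congr (_ + _).
by apply: eq_bigr => j _; rewrite !mxE ord1.
Qed.

Lemma only_relu_maxmin_net : only_relu (maxmin_net q0 B).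
Proof.
split; last exact: only_relu_compile.
by move=> i; rewrite tnth_nseq.
Qed.

Lemma architecture_maxmin_net :
  architecture (maxmin_net q0 B) = relu_architecture (hidden_dims d ms) q.
Proof.
rewrite /architecture /= layer_dims_compile activations_compile.
rewrite /relu_architecture /hidden_dims widths_maxmin /= card_form_index.
by rewrite -map_comp.
Qed.

Lemma depth_maxmin_net : depth (maxmin_net q0 B) =
  (up_log 2 smax + up_log 2 d.+1 + 2)%N.
Proof.
rewrite /depth /= layer_dims_compile size_rcons size_map widths_cascade.
rewrite size_cat !widths_tournament !size_map !size_iota.
by rewrite addn2 addnC.
Qed.

Lemma size_maxmin_net : (norm0 B <= n)%N ->
  (nn_size (maxmin_net q0 B) <=
    (\sum_i s i) * (d.+1 ^ 2 + 16 * d.+1 + 10) + 8 * n * up_log 2 smax)%N.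
Proof.
move=> Bn /=.
have S_E : (sumn ms = \sum_i s i)%N by rewrite sumnE big_map big_enum.
have nS : (n <= \sum_i s i)%N.
  by rewrite -{1}[n]card_ord -sum1_card; apply: leq_sum => i _; exact: s_gt0.
have hA : (norm0 form_mx <= (\sum_i s i) * d.+1 * d)%N.
  by apply: leq_trans (norm0_le_mul form_mx) _; rewrite card_form_index S_E.
have hb : (norm0 (vec c) <= (\sum_i s i) * d.+1)%N.
  by apply: leq_trans (norm0_le_mul (vec c)) _; rewrite muln1 card_form_index S_E.
have sparse1 : row_sparse 2 (1%:M : 'M[R]_#|form_index|).
  move=> r; apply: leq_trans (_ : #|[set r]%SET| <= 2)%N; last by rewrite cards1.
  apply: subset_leq_card; apply/fintype.subsetP => k; rewrite !inE mxE.
  by apply: contraR => /negPf; rewrite eq_sym => ->.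
have hc := size_compile maxmin_circuit q0 B sparse1.
have hw : (sumn (widths maxmin_circuit) <= (\sum_i s i) * d.+1 +
    (\sum_i s i) * up_log 2 d.+1 + (\sum_i s i + n * up_log 2 smax))%N.
  rewrite widths_cascade sumn_cat; apply: leq_add.
    apply: leq_trans (sumn_widths_tournament _ _ _ _) _.
    by rewrite sum_nat_const card_branch S_E.
  apply: leq_trans (sumn_widths_tournament _ _ _ _) _.
  by rewrite card_ord.
have hd : (up_log 2 d.+1 <= d.+1)%N.
  by apply: up_log_min => //; rewrite ltnW // ltn_expl.
exact: (entry_count_bound hA hb hc hw hd nS Bn).
Qed.

End Properties.

End MaxMinNetwork.

(** * Simplices and barycentric coordinates *)

Section Convexity.
Variable R : realType.

Lemma sum_continuous (T : topologicalType) (V : normedModType R) (I : Type)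
    (r : seq I) (P : pred I) (F : I -> T -> V) :
  (forall i, P i -> continuous (F i)) ->
  continuous (fun x => \sum_(i <- r | P i) F i x).
Proof. by move=> cF; apply: continuous_big => //; exact: add_continuous. Qed.

Definition std_simplex m : set 'rV[R]_m :=
  [set v | (forall i, 0 <= v ord0 i) /\ \sum_i v ord0 i = 1].

Lemma std_simplex_compact m : compact (@std_simplex m).
Proof.
apply: (@subclosed_compact _ _
  [set v : 'rV[R]_m | forall i, `[0, 1]%classic (v ord0 i)]).
- rewrite (_ : @std_simplex m =
      \bigcap_i [set v : 'rV[R]_m | 0 <= v ord0 i] `&`
      [set v : 'rV[R]_m | \sum_i v ord0 i = 1]); last first.
    apply/seteqP; split=> v [h1 h2]; split=> // i; [move=> _|];
    exact: h1.
  apply: closedI.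
    apply: closed_bigI => i _.
    apply: (@preimage_closed _ _ (fun v : 'rV[R]_m => v ord0 i : R^o) [set x | 0 <= x]).
      by move=> v _; exact: coord_continuous.
    exact: closed_ge.
  apply: (@preimage_closed _ _ (fun v : 'rV[R]_m => \sum_i v ord0 i : R^o)
    [set x | x = 1]).
    by move=> v _; apply: sum_continuous => i _; exact: coord_continuous.
  exact: closed_eq.
- exact: (@rV_compact (R : ptopologicalType) m _ (fun=> @segment_compact R 0 1)).
- move=> v [v0 v1] i; rewrite /= in_itv /= v0 /= -v1 (bigD1 i) //= lerDl.
  exact: sumr_ge0.
Qed.

Variable d : nat.
Notation point := 'cV[R]_d.
Local Notation conv := Defs.conv.
Implicit Types (Y Z : {fset point}) (x y z : point).

Definition hull Y : set point :=
  [set x | exists l : point -> R,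
    [/\ forall y, y \in Y -> 0 <= l y,
        \sum_(y <- Y) l y = 1
      & x = \sum_(y <- Y) l y *: y]].

Lemma conv_hull Y : conv Y `<=` hull Y.
Proof. by move=> x [l [l0 l1 ->]]; exists l; split=> // y /l0/ltW. Qed.

Lemma sum_fsubset (V : nmodType) Y Z (F : point -> V) : (Z `<=` Y)%fset ->
  \sum_(y <- Y | y \in Z) F y = \sum_(y <- Z) F y.
Proof.
move=> ZY; rewrite -big_filter; apply: perm_big; apply: uniq_perm.
- by rewrite filter_uniq.
- exact: fset_uniq.
by move=> y; rewrite mem_filter andb_idr // => /(fsubsetP ZY).
Qed.

Lemma weights_extend Y Z (l : point -> R) : (Z `<=` Y)%fset ->
  let k y := if y \in Z then l y else 0 in
  \sum_(y <- Y) k y = \sum_(y <- Z) l y /\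
  \sum_(y <- Y) k y *: y = \sum_(y <- Z) l y *: y.
Proof.
move=> ZY k; rewrite -!(sum_fsubset _ ZY) /k -big_mkcond; split=> //.
rewrite [RHS]big_mkcond; apply: eq_bigr => y _.
by case: ifP => // _; rewrite scale0r.
Qed.

Lemma hullS Y Z : (Y `<=` Z)%fset -> hull Y `<=` hull Z.
Proof.
move=> /weights_extend YZ x [l [l0 l1 ->]]; have [k1 kE] := YZ l.
exists (fun y => if y \in Y then l y else 0); split; rewrite ?k1 ?kE //.
by move=> y _; case: ifP => // /l0.
Qed.

Lemma mem_hull Y y : y \in Y -> hull Y y.
Proof.
move=> yY; exists (fun z => (z == y)%:R); split=> [z _||].
- exact: ler0n.
- rewrite (big_fsetD1 y) //= eqxx big_seq big1 ?addr0 // => z.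
  by rewrite !inE => /andP[/negPf ->].
- rewrite (big_fsetD1 y) //= eqxx scale1r big_seq big1 ?addr0 // => z.
  by rewrite !inE => /andP[/negPf -> _]; rewrite scale0r.
Qed.

(** The hull is the image of the compact standard simplex. *)
Lemma hull_compact Y : compact (hull Y).
Proof.
pose f (v : 'rV[R]_(size Y)) : point := \sum_i v ord0 i *: nth 0 Y i.
have -> : hull Y = f @` @std_simplex (size Y).
  apply/seteqP; split=> x.
    move=> [l [l0 l1 ->]]; exists (\row_i l (nth 0 Y i)).
      split=> [i|]; first by rewrite mxE l0 // mem_nth.
      by under eq_bigr do rewrite mxE; rewrite -l1 (big_nth 0) big_mkord.
    rewrite /f (big_nth 0) big_mkord; apply: eq_bigr => i _.
    by rewrite mxE.
  move=> [v [v0 v1] <-].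
  pose l y := if insub (index y Y) is Some i then v ord0 i else 0.
  have lE (i : 'I_(size Y)) : l (nth 0 Y i) = v ord0 i.
    by rewrite /l index_uniq // ?fset_uniq // valK.
  exists l; split=> [y yY||].
  - by rewrite /l; case: insub.
  - rewrite (big_nth 0) big_mkord -v1; apply: eq_bigr => i _; exact: lE.
  - by rewrite (big_nth 0) big_mkord /f; apply: eq_bigr => i _; rewrite lE.
apply: continuous_compact; last exact: std_simplex_compact.
apply: continuous_subspaceT; apply: sum_continuous => i _ v.
by apply: cvgZr_tmp; [exact: nbhs_filter|exact: coord_continuous].
Qed.

Lemma hull_closed Y : closed (hull Y).
Proof.
by apply: compact_closed; [exact: norm_hausdorff|exact: hull_compact].
Qed.

(** The half-open segment from [b] to [x] lies in the open hull. *)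
Lemma segment_closure Y x b : hull Y x -> conv Y b ->
  closure (conv Y) x.
Proof.
move=> [l [l0 l1 xE]] [k [k0 k1 bE]] B Bx.
pose f (t : R) := x + t *: (b - x).
have f0 : f t @[t --> 0^'+] --> x.
  rewrite -[x in _ --> x]addr0 -[X in _ + X](scale0r (b - x)).
  apply: cvgD; first exact: cvg_cst.
  by apply: cvgZr_tmp; exact: cvg_at_right_filter.
have : \forall t \near 0^'+, conv Y (f t) /\ B (f t).
  near=> t; split; last by near: t; exact: f0.
  have t0 : 0 < t by near: t; exact: nbhs_right_gt.
  have t1 : t < 1 by near: t; exact: nbhs_right_lt.
  exists (fun y => (1 - t) * l y + t * k y); split.
  - by move=> y yY; have := l0 y yY; have := k0 y yY; nra.
  - by rewrite big_split /= -!mulr_sumr l1 k1; lra.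
  - rewrite /f xE bE; under [RHS]eq_bigr do rewrite scalerDl -!scalerA.
    rewrite big_split /= -!scaler_sumr scalerBr scalerBl scale1r.
    by rewrite addrCA addrC addrAC; congr (_ + _); rewrite addrC.
move=> near_f.
have [t [ct Bt]] := @filter_ex _ _ (at_right_proper_filter (0 : R)) _ near_f.
by exists (f t).
Unshelve. all: by end_near. Qed.

Lemma conv_nonempty Y : Y != fset0 -> conv Y !=set0.
Proof.
move=> Y0; have Yn : 0 < (#|` Y|%:R : R) by rewrite ltr0n cardfs_gt0.
exists (\sum_(y <- Y) #|` Y|%:R^-1 *: y), (fun=> #|` Y|%:R^-1); split=> //.
  by move=> y _; rewrite invr_gt0.
rewrite big_const_seq count_predT iter_addr_0 -[LHS]mulr_natr.
by rewrite mulVf // gt_eqF.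
Qed.

Lemma closure_conv Y : closure (conv Y) = hull Y.
Proof.
apply/seteqP; split.
  rewrite [X in _ `<=` X](closure_id _).1; last exact: hull_closed.
  by apply: closure_subset; exact: conv_hull.
move=> x hx; have [Y0|/conv_nonempty[b]] := eqVneq Y fset0.
  by case: hx => l [_]; rewrite Y0 big_seq_fset0 => /eqP; rewrite eq_sym oner_eq0.
exact: segment_closure.
Qed.

Lemma affind_weights Y (l k : point -> R) : affinely_independent Y ->
  \sum_(y <- Y) l y = \sum_(y <- Y) k y ->
  \sum_(y <- Y) l y *: y = \sum_(y <- Y) k y *: y ->
  forall y, y \in Y -> l y = k y.
Proof.
move=> Yi lk1 lk2 y yY; apply/eqP; rewrite -subr_eq0; apply/eqP.
apply: (Yi (fun y => l y - k y)) => //.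
  by rewrite sumrB lk1 subrr.
by under eq_bigr do rewrite scalerBl; rewrite sumrB lk2 subrr.
Qed.

Lemma affindS Y Z : (Z `<=` Y)%fset -> affinely_independent Y ->
  affinely_independent Z.
Proof.
move=> ZY Yi l l1 lE y yZ; have [k1 kE] := weights_extend l ZY.
have := Yi (fun y => if y \in Z then l y else 0).
by rewrite k1 kE => /(_ l1 lE y (fsubsetP ZY y yZ)); rewrite yZ.
Qed.

(** Vertices are extreme points: if [y] is a convex combination of the points
  of [Z], compare coefficients of [y] after expanding these points in [Y].
  The coefficient 1 on the left forces some point of [Z] that occurs with a
  positive weight to have coefficient 1 at [y], hence to be [y]. *)
Lemma vertex_extreme Y Z y : affinely_independent Y -> y \in Y ->
  hull Z y -> (forall z, z \in Z -> hull Y z) -> y \in Z.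
Proof.
move=> Yi yY [m [m0 m1 mE]] ZY.
have /choice[k kP] : forall z, exists k : point -> R, z \in Z ->
    [/\ forall w, w \in Y -> 0 <= k w, \sum_(w <- Y) k w = 1
      & z = \sum_(w <- Y) k w *: w].
  move=> z; have [/ZY[k kz]|] := boolP (z \in Z); first by exists k.
  by exists (fun=> 0).
have k1 z : z \in Z -> k z y <= 1.
  move=> /kP[k0 <- _]; rewrite (big_fsetD1 y) //= lerDl big_seq.
  by apply: sumr_ge0 => w; rewrite !inE => /andP[_ /k0].
have coef : \sum_(z <- Z) m z * k z y = 1.
  have [d1 dE] : \sum_(w <- Y) (w == y)%:R = 1 :> R /\
      \sum_(w <- Y) (w == y)%:R *: w = y.
    rewrite !(big_fsetD1 y yY) /= eqxx scale1r !big_seq !big1 ?addr0 // => w;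
      by rewrite !inE => /andP[/negPf -> _]; rewrite ?scale0r.
  have <- : (y == y)%:R = 1 :> R by rewrite eqxx.
  apply: (affind_weights (k := fun w => (w == y)%:R)
    (l := fun w => \sum_(z <- Z) m z * k z w) Yi _ _ yY).
    rewrite d1 exchange_big /= -m1 big_seq [RHS]big_seq.
    by apply: eq_bigr => z /kP[_ kz1 _]; rewrite -mulr_sumr kz1 mulr1.
  rewrite dE [RHS]mE; under eq_bigr do rewrite scaler_suml.
  rewrite exchange_big /= big_seq [RHS]big_seq.
  apply: eq_bigr => z /kP[_ _ kzE]; under eq_bigr do rewrite -scalerA.
  by rewrite -scaler_sumr -kzE.
have [z zZ mz] : exists2 z, z \in Z & m z != 0.
  apply: contrapT => h; suff /eqP : 0 = 1 :> R by rewrite eq_sym oner_eq0.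
  rewrite -m1 big_seq big1 // => z zZ.
  by apply: contrapT => mz; apply: h; exists z => //; apply/eqP.
have kzy : k z y = 1.
  have : \sum_(w <- Z) m w * (1 - k w y) = 0.
    by under eq_bigr do rewrite mulrBr mulr1; rewrite sumrB m1 coef subrr.
  rewrite big_seq => /eqP; rewrite psumr_eq0; last first.
    by move=> w wZ; rewrite mulr_ge0 ?m0 // subr_ge0 k1.
  move=> /allP /(_ z zZ); rewrite zZ /= mulf_eq0 (negPf mz) /= subr_eq0.
  by move=> /eqP.
have [kz0 kz1 kzE] := kP z zZ.
suff -> : y = z by [].
rewrite kzE (big_fsetD1 y) //= kzy scale1r big_seq big1 ?addr0 // => w wY.
suff -> : k z w = 0 by rewrite scale0r.
move: kz1; rewrite (big_fsetD1 y) //= kzy => /eqP.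
rewrite -subr_eq0 addrAC subrr add0r big_seq psumr_eq0.
  by move=> /allP /(_ w wY); rewrite wY /= => /eqP.
by move=> v; rewrite !inE => /andP[_ /kz0].
Qed.

Lemma conv_subset Y Z : affinely_independent Y -> conv Y = conv Z ->
  (Y `<=` Z)%fset.
Proof.
move=> Yi YZ; have hYZ : hull Y = hull Z by rewrite -!closure_conv YZ.
apply/fsubsetP => y yY; apply: (vertex_extreme Yi yY).
  by rewrite -hYZ; exact: mem_hull.
by move=> z zZ; rewrite hYZ; exact: mem_hull.
Qed.

Lemma conv_inj Y Z : affinely_independent Y -> affinely_independent Z ->
  conv Y = conv Z -> Y = Z.
Proof.
by move=> Yi Zi YZ; apply/eqP; rewrite eqEfsubset !conv_subset.
Qed.

Definition affine (f : point -> R) :=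
  exists (a : 'rV[R]_d) (c : R), forall x, f x = (a *m x) 0 0 + c.

Lemma affine_continuous (f : point -> R) : affine f -> continuous (f : point -> R^o).
Proof.
move=> [a [c fE]]; rewrite (_ : f = fun x => \sum_j a 0 j *: (x j 0 : R^o) + c).
  move=> x; apply: (@continuousD _ _ _ (fun x : point => _) (fun=> c));
    last exact: cst_continuous.
  apply: (@sum_continuous _ _ _ _ _ (fun j (x : point) => a 0 j *: (x j 0 : R^o))).
  by move=> j _ {}x; apply: cvgZl_tmp; [exact: nbhs_filter|exact: coord_continuous].
by apply/funext => x; rewrite fE mxE.
Qed.

Lemma affine_comb (I : Type) (r : seq I) (k : I -> R) (y : I -> point) f :
  affine f -> \sum_(i <- r) k i = 1 ->
  f (\sum_(i <- r) k i *: y i) = \sum_(i <- r) k i * f (y i).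
Proof.
move=> [a [c fE]] k1; rewrite fE mulmx_sumr summxE.
under [RHS]eq_bigr do rewrite fE mulrDr.
rewrite big_split /= -mulr_suml k1 mul1r; congr (_ + _).
by apply: eq_bigr => i _; rewrite -scalemxAr mxE.
Qed.

(** Barycentric coordinates as affine functions on the whole space; they exist
  if [Y] is the vertex set of a full-dimensional simplex. *)
Definition barycentric Y (b : point -> point -> R) :=
  [/\ forall y, affine (b y),
      forall x, \sum_(y <- Y) b y x = 1
    & forall x, \sum_(y <- Y) b y x *: y = x].

(** The rows [(y, 1)], [y] in [Y], form an invertible matrix, and the
  coordinates of [x] are [(x, 1)] times its inverse. *)
Lemma barycentric_exists Y : affinely_independent Y -> #|` Y| = d.+1 ->
  exists b, barycentric Y b.
Proof.
move=> Yi Yd; have Ysize : size Y = (d + 1)%N by rewrite addn1.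
pose M : 'M[R]_(d + 1) :=
  \matrix_i row_mx (nth 0 Y i)^T (1%:M : 'M[R]_1).
have mulM (u : 'rV_(d + 1)) : u *m M =
    row_mx (\sum_i u 0 i *: nth 0 Y i)^T (\sum_i u 0 i)%:M.
  apply/rowP => j; rewrite [LHS]mxE; case: (split_ordP j) => j' ->.
    rewrite row_mxEl mxE summxE; apply: eq_bigr => i _.
    by rewrite [M i _]mxE row_mxEl !mxE.
  rewrite row_mxEr mxE ord1 eqxx mulr1n; apply: eq_bigr => i _.
  by rewrite [M i _]mxE row_mxEr mxE eqxx mulr1.
have Mu : M \in unitmx.
  rewrite -row_free_unit; apply: inj_row_free => u.
  rewrite mulM => uM.
  have /eq_row_mx[/eqP u1 /matrixP/(_ 0 0)] := etrans uM (esym (row_mx0 R 1 d 1)).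
  rewrite !mxE eqxx mulr1n => u0; apply/rowP => i; rewrite mxE.
  pose l y := if insub (index y Y) is Some i then u 0 i else 0.
  have lE (k : 'I_(d + 1)) : l (nth 0 Y k) = u 0 k.
    by rewrite /l index_uniq ?Ysize // ?fset_uniq // valK.
  rewrite -lE; apply: (Yi l); last by rewrite mem_nth ?Ysize.
    rewrite (big_nth 0) big_mkord Ysize -[RHS]u0.
    by apply: eq_bigr => k _; exact: lE.
  move: u1; rewrite trmx_eq0 => /eqP u1.
  rewrite (big_nth 0) big_mkord Ysize -[RHS]u1.
  by apply: eq_bigr => k _; rewrite lE.
pose w x : 'rV_(d + 1) := row_mx x^T (1%:M : 'M[R]_1) *m invmx M.
exists (fun y x => if insub (index y Y) is Some i then w x 0 i else 0).
have wE x : \sum_i w x 0 i *: nth 0 Y i = x /\ \sum_i w x 0 i = 1.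
  have := mulM (w x); rewrite /w mulmxKV // => /eq_row_mx[/trmx_inj <-].
  by move=> /matrixP/(_ 0 0); rewrite !mxE eqxx !mulr1n.
split=> [y|x|x].
- rewrite /w; case: insub => [i|]; last first.
    by exists 0, 0 => x; rewrite mul0mx mxE addr0.
  have [U [D ->]] : exists U D, invmx M = col_mx U D.
    by exists (usubmx (invmx M)), (dsubmx (invmx M)); rewrite vsubmxK.
  exists (col i U)^T, (D 0 i) => x.
  rewrite mul_row_col mul1mx mxE; congr (_ + _); rewrite !mxE.
  by apply: eq_bigr => k _; rewrite !mxE mulrC.
- rewrite (big_nth 0) big_mkord Ysize -[RHS](wE x).2; apply: eq_bigr => i _.
  by rewrite index_uniq ?Ysize // ?fset_uniq // valK.
- rewrite (big_nth 0) big_mkord Ysize -[RHS](wE x).1; apply: eq_bigr => i _.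
  by rewrite index_uniq ?Ysize // ?fset_uniq // valK.
Qed.

Section Barycentric.
Variables (Y : {fset point}) (b : point -> point -> R).
Hypotheses (Yi : affinely_independent Y) (bY : barycentric Y b).

Lemma barycentric_weights (l : point -> R) y : \sum_(z <- Y) l z = 1 ->
  y \in Y -> b y (\sum_(z <- Y) l z *: z) = l y.
Proof.
case: bY => _ b1 bE l1 yY.
by apply: (affind_weights Yi (l := fun z => b z _) _ _ yY); rewrite ?b1 ?bE.
Qed.

Lemma barycentric_vertex y z : y \in Y -> z \in Y -> b y z = (y == z)%:R.
Proof.
move=> yY zY; rewrite -{1}(_ : \sum_(w <- Y) (w == z)%:R *: w = z).
  apply: barycentric_weights => //.
  rewrite (big_fsetD1 z) //= eqxx big_seq big1 ?addr0 // => w.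
  by rewrite !inE => /andP[/negPf ->].
rewrite (big_fsetD1 z) //= eqxx scale1r big_seq big1 ?addr0 // => w.
by rewrite !inE => /andP[/negPf -> _]; rewrite scale0r.
Qed.

Lemma hull_barycentric x : hull Y x <-> forall y, y \in Y -> 0 <= b y x.
Proof.
have [_ b1 bE] := bY; split=> [[l [l0 l1 ->]] y yY|bx].
  by rewrite barycentric_weights // l0.
by exists (b^~ x); rewrite b1 bE.
Qed.

Lemma affine_barycentric f x : affine f ->
  f x = \sum_(y <- Y) b y x * f y.
Proof.
have [_ b1 bE] := bY => fa.
by rewrite -{1}(bE x); rewrite (affine_comb (fun y => y) fa).
Qed.

End Barycentric.

End Convexity.

(** * Tents over a pair of simplices *)

Section TwoSimplices.
Variables (R : realType) (d : nat).
Notation point := 'cV[R]_d.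
Local Notation conv := Defs.conv.

Lemma hull_face (Y Z : {fset point}) b x w : affinely_independent Y ->
  barycentric Y b -> (Z `<=` Y)%fset -> hull Z x ->
  w \in Y -> w \notin Z -> b w x = 0.
Proof.
move=> Yi bY ZY [l [_ l1 ->]] wY wZ; have [k1 kE] := weights_extend l ZY.
by rewrite -kE (barycentric_weights Yi bY) ?k1 // (negPf wZ).
Qed.

Lemma affine_segment (f : point -> R) x y e : affine f ->
  f ((1 - e) *: x + e *: y) = (1 - e) * f x + e * f y.
Proof.
move=> [a [c fE]]; rewrite !fE mulmxDr -!scalemxAr !mxE; ring.
Qed.

Variables (Y Y' : {fset point}) (b b' : point -> point -> R).
Hypotheses (Yi : affinely_independent Y) (Y'i : affinely_independent Y').
Hypotheses (bY : barycentric Y b) (bY' : barycentric Y' b').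
Hypothesis common_face : hull Y `&` hull Y' `<=` hull (Y `&` Y')%fset.

(** If [b q y] were nonnegative for all [q] outside the common face [F], then a
  short step from an interior point [x0] of [F] towards [y] would stay in both
  hulls, hence in the hull of [F]; but it leaves the face of [Y'] spanned by
  [F], as [y] is in the opposite face. *)
Lemma opposite_face_negative y : hull (Y' `\` Y)%fset y ->
  exists2 q, q \in (Y `\` Y')%fset & b q y < 0.
Proof.
move=> yG; apply: contrapT => nex.
have by_ge0 q : q \in Y -> q \notin Y' -> 0 <= b q y.
  move=> qY qY'; rewrite leNgt; apply/negP => lt0; apply: nex.
  by exists q => //; rewrite in_fsetD qY qY'.
have [ba b1 bE] := bY; have [ba' b1' bE'] := bY'.
have yY' : hull Y' y by apply: hullS yG; exact: fsubsetDl.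
have [F0|F0] := eqVneq (Y `&` Y')%fset fset0.
  have yY : hull Y y.
    apply/(hull_barycentric Yi bY) => q qY; apply: by_ge0 => //.
    apply/negP => qY'; have : q \in (Y `&` Y')%fset by rewrite in_fsetI qY.
    by rewrite F0.
  have := common_face (conj yY yY'); rewrite F0 => -[l [_]].
  by rewrite big_seq_fset0 => /eqP; rewrite eq_sym oner_eq0.
set F := (Y `&` Y')%fset in F0 *.
have Fn : 0 < (#|` F|%:R : R) by rewrite ltr0n cardfs_gt0.
pose de : R := #|` F|%:R^-1.
have de0 : 0 < de by rewrite invr_gt0.
have sum_de : \sum_(f <- F) de = 1.
  by rewrite big_const_seq count_predT iter_addr_0 -[LHS]mulr_natr mulVf // gt_eqF.
pose x0 := \sum_(f <- F) de *: f.
have x0F : hull F x0 by exists (fun=> de); split=> // *; exact: ltW.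
have x0Y : hull Y x0 by apply: hullS x0F; exact: fsubsetIl.
have x0Y' : hull Y' x0 by apply: hullS x0F; exact: fsubsetIr.
have bx0 f : f \in F -> b f x0 = de.
  move=> fF; have [fY fY'] : f \in Y /\ f \in Y' by apply/andP; rewrite -in_fsetI.
  rewrite /x0 (affine_comb (fun y => y) (ba f) sum_de) (big_fsetD1 f) //=.
  rewrite (barycentric_vertex Yi bY) // eqxx mulr1 big_seq big1 ?addr0 // => g.
  rewrite !inE => /and3P[gf gY gY'].
  by rewrite (barycentric_vertex Yi bY) // eq_sym (negPf gf) mulr0.
pose M := \sum_(f <- F) `|b f y|.
have M0 : 0 <= M by apply: sumr_ge0.
have bM f : f \in F -> - M <= b f y.
  move=> fF; rewrite lerNl (le_trans (ler_norm _)) // normrN.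
  by rewrite /M (big_fsetD1 f) //= lerDl sumr_ge0.
(* with this step the loss is at most the gain at every common vertex:
   [e * M = (1 - e) * de] *)
pose e := de / (de + M).
have e0 : 0 < e by rewrite divr_gt0 // ltr_wpDr.
have eE : e * (de + M) = de by rewrite divfK // gt_eqF // ltr_wpDr.
have e1 : e <= 1 by rewrite ler_pdivrMr ?mul1r ?lerDl // ltr_wpDr.
pose z := (1 - e) *: x0 + e *: y.
have zY : hull Y z.
  apply/(hull_barycentric Yi bY) => q qY; rewrite affine_segment //.
  have [qY'|qY'] := boolP (q \in Y').
    have qF : q \in F by rewrite in_fsetI qY.
    by rewrite bx0 //; have := bM q qF; nra.
  apply: addr_ge0; apply: mulr_ge0; rewrite ?subr_ge0 ?(ltW e0) //.
    exact: (hull_barycentric Yi bY x0).1.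
  exact: by_ge0.
have zY' : hull Y' z.
  apply/(hull_barycentric Y'i bY') => q qY; rewrite affine_segment //.
  apply: addr_ge0; apply: mulr_ge0; rewrite ?subr_ge0 ?(ltW e0) //.
    exact: (hull_barycentric Y'i bY' x0).1.
  exact: (hull_barycentric Y'i bY' y).1.
have zF : hull F z := common_face (conj zY zY').
suff : \sum_(w <- Y') b' w y = 0 by rewrite b1' => /eqP; rewrite oner_eq0.
rewrite big_seq big1 // => w wY'.
have FY' : (F `<=` Y')%fset by exact: fsubsetIr.
have [wF|wF] := boolP (w \in F).
  apply: (hull_face Y'i bY' _ yG) => //; first exact: fsubsetDl.
  by move: wF; rewrite in_fsetI => /andP[wY _]; rewrite in_fsetD wY.
have := hull_face Y'i bY' FY' zF wY' wF.
rewrite affine_segment // (hull_face Y'i bY' FY' x0F) // mulr0 add0r.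
by move=> /eqP; rewrite mulf_eq0 gt_eqF //= => /eqP.
Qed.

(** Twice the sum of the negative parts of the coordinates [b q], [q] outside
  the common face, is continuous and positive on a compact set, so it has a
  positive lower bound. *)
Lemma opposite_face_separation : exists2 c : R, 0 < c &
  forall y, hull (Y' `\` Y)%fset y ->
  exists2 q, q \in (Y `\` Y')%fset & b q y <= - c.
Proof.
have [ba _ _] := bY; set G := (Y' `\` Y)%fset; set Q := (Y `\` Y')%fset.
have [G0|[y0 y0G]] := fset_0Vmem G.
  exists 1 => // y; rewrite G0 => -[l [_]].
  by rewrite big_seq_fset0 => /eqP; rewrite eq_sym oner_eq0.
pose h y := \sum_(q <- Q) (`|b q y| - b q y).
have hc : continuous (h : point -> R^o).
  apply: (@sum_continuous _ _ R^o) => q _ y.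
  have bc := @affine_continuous _ _ _ (ba q).
  apply: (@continuousB _ _ _ (fun y => `|b q y| : R^o) (fun y => b q y : R^o)).
    apply: (continuous_comp (bc y)); exact: norm_continuous.
  exact: bc.
have [y1 y1G h_min] := compact_EVT_min (ex_intro _ y0 (mem_hull y0G))
  (@hull_compact _ _ G) (@continuous_subspaceT _ _ _ _ hc).
have term_ge0 q y : 0 <= `|b q y| - b q y by rewrite subr_ge0 ler_norm.
have h1 : 0 < h y1.
  have [q qQ bq] := opposite_face_negative (set_mem y1G).
  rewrite /h (big_fsetD1 q) //= ltr_pwDl ?sumr_ge0 //.
  by rewrite subr_gt0 (lt_le_trans bq).
pose c := h y1 / (2 * (#|` Q|.+1)%:R).
have c0 : 0 < c by rewrite divr_gt0 // mulr_gt0 // ltr0n.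
exists c => // y yG; apply: contrapT => nex.
have : h y <= \sum_(q <- Q) 2 * c.
  rewrite /h big_seq [leRHS]big_seq; apply: ler_sum => q qQ.
  have : - c < b q y.
    by rewrite ltNge; apply/negP => le_c; apply: nex; exists q.
  by case: (ger0P (b q y)); lra.
rewrite big_const_seq count_predT iter_addr_0 -[leRHS]mulr_natr => hQ.
have := h_min y (mem_set yG); have : c * (2 * (#|` Q|.+1)%:R) = h y1.
  by rewrite divfK // mulf_neq0 // pnatr_eq0.
by rewrite -natr1; nra.
Qed.

(** On the hull of [Y'] let [t] be the total weight of the vertices outside the
  common face.  The difference [D] of [b p] and the hat function is at most
  [C * t], since it is affine and vanishes at the common vertices, whereas some
  coordinate [b q] with [q] outside the common face is at most [- c * t].  So
  the slope [C / c] is large enough.  The right-hand side of the inequality is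
  the hat function of [p] on the hull of [Y']. *)
Lemma tent_below_hat p : p \in Y -> exists2 N0 : R, 0 <= N0 &
  forall N x, N0 <= N -> hull Y' x ->
  exists2 q, q \in Y & b p x + (if q == p then 0 else N * b q x) <=
                       (if p \in Y' then b' p x else 0).
Proof.
move=> pY; have [ba b1 bE] := bY; have [ba' b1' bE'] := bY'.
set G := (Y' `\` Y)%fset; have GY' : (G `<=` Y')%fset by exact: fsubsetDl.
have [c c0 sep] := opposite_face_separation; rewrite -/G in sep.
pose u x := if p \in Y' then b' p x else 0.
pose D x := b p x - u x.
have Da : affine D.
  have [a [k bpE]] := ba p; rewrite /D /u; case: (p \in Y').
    have [a' [k' bpE']] := ba' p; exists (a - a'), (k - k') => x.
    by rewrite bpE bpE' mulmxBl !mxE; ring.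
  by exists a, k => x; rewrite subr0.
have DF w : w \in Y' -> w \notin G -> D w = 0.
  move=> wY'; rewrite in_fsetD wY' andbT negbK => wY; rewrite /D /u.
  rewrite (barycentric_vertex Yi bY) //; case: ifP => [pY'|].
    by rewrite (barycentric_vertex Y'i bY') // subrr.
  by rewrite subr0; case: eqVneq => // ->; rewrite wY'.
pose C := \sum_(w <- G) `|D w|.
have C0 : 0 <= C by apply: sumr_ge0.
exists (C / c); first by rewrite divr_ge0 // ltW.
move=> N x; rewrite ler_pdivrMr // => Nc /(hull_barycentric Y'i bY') xY'.
have sumG (f : point -> R) :
    (forall w, w \in Y' -> w \notin G -> f w = 0) ->
    \sum_(w <- Y') b' w x * f w = \sum_(w <- G) b' w x * f w.
  move=> f0; rewrite (bigID (mem G)) /= [X in _ + X]big_seq_cond [X in _ + X]big1.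
    by rewrite addr0 (sum_fsubset _ GY').
  by move=> w /andP[wY' wG]; rewrite f0 // mulr0.
pose t := \sum_(w <- G) b' w x.
have bG w : w \in G -> 0 <= b' w x by move=> /(fsubsetP GY'); exact: xY'.
have t0 : 0 <= t by rewrite /t big_seq; apply: sumr_ge0.
have DC : D x <= C * t.
  rewrite (affine_barycentric bY' _ Da) sumG // mulr_sumr big_seq [leRHS]big_seq.
  apply: ler_sum => w wG; rewrite mulrC ler_wpM2r ?bG //.
  by rewrite (le_trans (ler_norm _)) // /C (big_fsetD1 w) //= lerDl sumr_ge0.
have [t00|tn0] := eqVneq t 0.
  exists p => //; rewrite eqxx addr0 -subr_le0.
  by move: DC; rewrite t00 mulr0.
have tp : 0 < t by rewrite lt_neqAle eq_sym tn0.
pose y := \sum_(w <- G) (b' w x / t) *: w.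
have y1 : \sum_(w <- G) b' w x / t = 1 by rewrite -mulr_suml divff.
have [|q] := sep y.
  by exists (fun w => b' w x / t); split=> // w wG; rewrite divr_ge0 ?bG.
rewrite in_fsetD => /andP[qY' qY] bqy.
have bqx : b q x = t * b q y.
  rewrite (affine_barycentric bY' _ (ba q)) sumG; last first.
    move=> w wY'; rewrite in_fsetD wY' andbT negbK => wY.
    rewrite (barycentric_vertex Yi bY) //; case: eqVneq => // qw.
    by move: qY'; rewrite qw wY'.
  rewrite (affine_comb (fun y => y) (ba q) y1) mulr_sumr.
  by apply: eq_bigr => w _; rewrite mulrA mulrCA mulfV // mulr1.
exists q => //; case: eqVneq => [qp|qp].
  rewrite addr0 -qp (negPf qY') bqx.
  by nra.
have : b p x <= u x + C * t by move: DC; rewrite /D; lra.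
have N0 : 0 <= N by rewrite -(pmulr_lge0 _ c0) (le_trans C0).
have h1 : N * t * b q y <= N * t * - c by rewrite ler_wpM2l ?mulr_ge0.
have h2 : C * t <= N * c * t by rewrite ler_wpM2r.
rewrite -/(u x) bqx; lra.
Qed.

End TwoSimplices.

(** * Hat functions of a triangulation *)

Section Mesh.
Variables (R : realType) (d : nat).
Notation point := 'cV[R]_d.
Local Notation conv := Defs.conv.
Variables (Omega : set point) (TT : {fset set point}).

(** A choice of vertex sets and barycentric coordinates.  The second part is the
  form in which the regularity of the mesh enters the estimates. *)
Definition mesh_frame (V : set point -> {fset point})
    (b : set point -> point -> point -> R) : Prop :=
  (forall T, T \in TT ->
    [/\ affinely_independent (V T), #|` V T| = d.+1, T = conv (V T)
      & barycentric (V T) (b T)]) /\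
  (forall T T', T \in TT -> T' \in TT ->
    hull (V T) `&` hull (V T') `<=` hull (V T `&` V T')%fset).

(** The definition of a regular mesh names the vertices of a simplex separately
  for each of its faces; they agree because the open hull determines the
  vertices ([conv_inj]). *)
Lemma mesh_frame_exists : regular_triangulation TT Omega ->
  exists V b, mesh_frame V b.
Proof.
move=> [simp _ _ common].
have /choice[V VP] : forall T, exists Y : {fset point}, T \in TT ->
    #|` Y| = d.+1 /\ simplex_on Y T.
  move=> T; have [/simp[Y Yd YT]|_] := boolP (T \in TT); first by exists Y.
  by exists fset0.
have /choice[b bP] : forall T, exists b, T \in TT -> barycentric (V T) b.
  move=> T; have [TT_T|_] := boolP (T \in TT); last by exists (fun _ _ => 0).
  have [Vd [Vi _]] := VP T TT_T.
  by have [b bV] := barycentric_exists Vi Vd; exists b.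
exists V, b; split=> [T TT_T|T T' TT_T TT_T'].
  by have [Vd [Vi VT]] := VP T TT_T; split=> //; exact: bP.
have [_ [Vi VT]] := VP T TT_T; have [_ [Vi' VT']] := VP T' TT_T'.
have [->|TnT'] := pselect (T = T'); first by rewrite fsetIid => x [].
rewrite -!closure_conv -VT -VT'.
have [->|[S [[Y [Z [[Yi YT] Z0 ZY SZ]]] [Y' [Z' [[Yi' YT'] _ ZY' SZ']]] ->]]] //
  := common T T' TT_T TT_T' TnT'.
have ZZ' : Z = Z'.
  by apply: conv_inj; rewrite -?SZ ?SZ' //; [exact: affindS Yi|exact: affindS Yi'].
rewrite SZ (conv_inj Vi Yi) -?VT // (conv_inj Vi' Yi') -?VT' //.
rewrite !closure_conv; apply: hullS; rewrite fsubsetI ZY.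
by rewrite ZZ' ZY'.
Qed.

Section Frame.
Variables (V : set point -> {fset point}) (b : set point -> point -> point -> R).
Hypothesis regular : regular_triangulation TT Omega.
Hypothesis frame : mesh_frame V b.

Lemma closure_simplex T : T \in TT -> closure T = hull (V T).
Proof. by move=> /frame.1[_ _ VT _]; rewrite {1}VT closure_conv. Qed.

Lemma vertices_frame q : vertices TT q <-> exists2 T, T \in TT & q \in V T.
Proof.
split=> [[T [Y [TT_T [Yi YT] qY]]]|[T TT_T qV]].
  exists T => //; have [Vi _ VT _] := frame.1 T TT_T.
  by rewrite (conv_inj Vi Yi) -?VT.
by exists T, (V T); have [Vi _ VT _] := frame.1 T TT_T; split.
Qed.

(** A vertex [q] of [T'] that lies in the closure of [T] lies in the hull of the
  common vertices, and is one of them since it is an extreme point. *)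
Lemma vertex_in_closure q T : vertices TT q -> T \in TT ->
  (q \in closure T) = (q \in V T).
Proof.
move=> /vertices_frame[T' TT_T' qV'] TT_T.
have [Vi' _ _ _] := frame.1 _ TT_T'.
apply/idP/idP; rewrite inE closure_simplex //; last exact: mem_hull.
move=> qT; have qF : hull (V T `&` V T')%fset q.
  by apply: frame.2 => //; split=> //; exact: mem_hull.
have : q \in (V T `&` V T')%fset.
  apply: (vertex_extreme Vi' qV' qF) => z.
  by rewrite in_fsetI => /andP[_]; exact: mem_hull.
by rewrite in_fsetI => /andP[].
Qed.

Lemma closure_cover x : closure Omega x <-> exists2 T, T \in TT & closure T x.
Proof. by have [_ _ -> _] := regular. Qed.

Lemma simplex_closure T x : T \in TT -> closure T x -> closure Omega x.
Proof. by move=> TT_T Tx; apply/closure_cover; exists T. Qed.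

(** Applied to an open simplex and to the domain, to extend formulas to the
  boundary. *)
Lemma eq_within_closure (A B : set point) (f g : point -> R) x :
  {within B, continuous f} -> {within B, continuous g} -> A `<=` B ->
  (forall y, A y -> f y = g y) -> closure A x -> B x -> f x = g x.
Proof.
move=> fc gc AB fg Ax Bx; apply/eqP; rewrite -subr_eq0 -normr_eq0.
apply: contrapT => /negP nz.
have e0 : 0 < `|f x - g x| / 2 by rewrite divr_gt0 // lt_def nz normr_ge0.
have near_x (h : point -> R) : {within B, continuous h} ->
    \forall y \near x, B y -> `|h x - h y| < `|f x - g x| / 2.
  move=> /subspace_continuousP /(_ x Bx) /cvgr_dist_lt /(_ _ e0).
  by rewrite near_withinE.
have [y [Ay [/(_ (AB y Ay)) hf /(_ (AB y Ay)) hg]]] :=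
  Ax _ (filterI (near_x f fc) (near_x g gc)).
have := ler_normB (f x - f y) (g x - g y).
by move: hf; rewrite (fg y Ay) opprB addrA subrK => hf; lra.
Qed.

Lemma CPwL_on_simplex w T x : CPwL TT Omega w -> T \in TT -> closure T x ->
  w x = \sum_(y <- V T) b T y x * w y.
Proof.
move=> [wc waff] TT_T Tx; have [Vi _ VT bV] := frame.1 T TT_T.
have [a [c wE]] := waff T TT_T.
pose h (y : point) := (a *m y) 0 0 + c.
have hc : continuous (h : point -> R^o) by apply: affine_continuous; exists a, c.
have wh z : closure T z -> w z = h z.
  move=> Tz; apply: (eq_within_closure wc (@continuous_subspaceT _ _ _ _ hc) _ wE Tz).
    by move=> y Ty; apply: (simplex_closure TT_T); exact: subset_closure.
  exact: simplex_closure Tz.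
rewrite wh // (affine_barycentric bV x (f := h)); last by exists a, c.
rewrite big_seq [RHS]big_seq; apply: eq_bigr => y yV; rewrite wh //.
by rewrite closure_simplex //; exact: mem_hull.
Qed.

Lemma CPwL_eq w w' : CPwL TT Omega w -> CPwL TT Omega w' ->
  (forall q, vertices TT q -> w q = w' q) ->
  forall x, closure Omega x -> w x = w' x.
Proof.
move=> wP wP' ww' x /closure_cover[T TT_T Tx].
rewrite (CPwL_on_simplex wP TT_T Tx) (CPwL_on_simplex wP' TT_T Tx).
rewrite big_seq [RHS]big_seq; apply: eq_bigr => y yV; rewrite ww' //.
by apply/vertices_frame; exists T.
Qed.

Section Tents.
Variables (n : nat) (p : 'I_n -> point).
Hypotheses (p_vert : range p = vertices TT).

Let s i := nb_simplices TT (p i).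

Lemma p_vertex i : vertices TT (p i).
Proof. by rewrite -p_vert; exists i. Qed.

Definition star i : {fset set point} := [fset T in TT | p i \in closure T]%fset.

Lemma starP i T : (T \in star i) = (T \in TT) && (p i \in V T).
Proof.
rewrite !inE /=; case: (boolP (T \in TT)) => //= TT_T.
by rewrite vertex_in_closure //; exact: p_vertex.
Qed.

Lemma star_gt0 i : (0 < s i)%N.
Proof.
rewrite cardfs_gt0; have [T TT_T pT] := (vertices_frame _).1 (p_vertex i).
by apply/fset0Pn; exists T; rewrite starP TT_T.
Qed.

(** The default value [set0] is never taken, as [tagged k] is less than the
  number of elements of the star. *)
Definition simplex_at (k : branch s) : set point :=
  nth set0 (star (tag k)) (tagged k).

Lemma simplex_atP (k : branch s) :
  simplex_at k \in TT /\ p (tag k) \in V (simplex_at k).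
Proof. by apply/andP; rewrite -starP mem_nth. Qed.

Definition tent_form (N : R) (t : form_index d s) (x : point) : R :=
  let T := simplex_at (tag t) in
  let q := nth 0 (V T) (tagged t) in
  let i := tag (tag t) in
  b T (p i) x + (if q == p i then 0 else N * b T q x).

Lemma tent_form_affine N t : affine (tent_form N t).
Proof.
have [TT_T _] := simplex_atP (tag t).
have [_ _ _ [ba _ _]] := frame.1 _ TT_T.
rewrite /tent_form; set T := simplex_at _; set q := nth _ _ _.
have [a [c aE]] := ba (p (tag (tag t))).
case: (q == _); first by exists a, c => x; rewrite addr0.
have [a' [c' aE']] := ba q; exists (a + N *: a'), (c + N * c') => x.
by rewrite aE aE' mulmxDl -scalemxAl !mxE; ring.
Qed.

(** One slope for all pairs of simplices; the sum of the finitely many slopes of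
  [tent_below_hat] will do, because these may be increased. *)
Definition steep_enough (N : R) : Prop :=
  forall i T T' x, T \in TT -> T' \in TT -> p i \in V T -> hull (V T') x ->
  exists2 q, q \in V T & b T (p i) x + (if q == p i then 0 else N * b T q x) <=
                         (if p i \in V T' then b T' (p i) x else 0).

Lemma steep_enough_exists : exists2 N : R, 0 <= N & steep_enough N.
Proof.
have /choice[N NP] : forall u : 'I_n * (set point * set point), exists N : R,
    0 <= N /\ (u.2.1 \in TT -> u.2.2 \in TT -> p u.1 \in V u.2.1 ->
    forall M x, N <= M -> hull (V u.2.2) x ->
    exists2 q, q \in V u.2.1 & b u.2.1 (p u.1) x +
        (if q == p u.1 then 0 else M * b u.2.1 q x) <=
      (if p u.1 \in V u.2.2 then b u.2.2 (p u.1) x else 0)).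
  move=> [i [T T']] /=.
  have [[TT_T [TT_T' pT]]|h] := pselect (T \in TT /\ T' \in TT /\ p i \in V T);
    last by exists 0; split=> // *; exfalso; exact: h.
  have [Vi _ _ bV] := frame.1 _ TT_T; have [Vi' _ _ bV'] := frame.1 _ TT_T'.
  have [N N0 NP] := tent_below_hat Vi Vi' bV bV' (frame.2 _ _ TT_T TT_T') pT.
  by exists N.
pose NN := \sum_i \sum_(T <- TT) \sum_(T' <- TT) N (i, (T, T')).
have N0 u : 0 <= N u by case: (NP u).
exists NN; first by do 3 (apply: sumr_ge0 => ? _).
move=> i T T' x TT_T TT_T' pT; apply: (NP (i, (T, T'))).2 => //=.
rewrite /NN (bigD1 i) //= (big_fsetD1 T) //= (big_fsetD1 T') //=.
rewrite -!addrA lerDl; repeat apply: addr_ge0; repeat (apply: sumr_ge0 => ? _) => //.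
Qed.

Section Tent.
Variables (N : R) (i0 : 'I_n).
Hypothesis N0 : 0 <= N.
Hypothesis steep : steep_enough N.

Definition tent (x : point) (i : 'I_n) : R :=
  run (maxmin_circuit d i0 star_gt0) (fun t => relu (tent_form N t x)) i.

(** The tents of all simplices around [p i] stay below the hat function, and the
  tent of [T'] itself attains it if [p i] is a vertex of [T'].  Otherwise the
  hat function is zero on [T'], and the rectification makes up for negative
  tents. *)
Lemma tent_hat T' x i : T' \in TT -> closure T' x ->
  tent x i = if p i \in V T' then b T' (p i) x else 0.
Proof.
move=> TT_T' T'x; rewrite closure_simplex // in T'x.
have [Vi' _ _ bV'] := frame.1 _ TT_T'.
have b'0 := (hull_barycentric Vi' bV' x).1 T'x.
set u := if _ then _ else _.
have u0 : 0 <= u by rewrite /u; case: ifP => // /b'0.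
have [m [mP [k vE] vm]] :=
  maxmin_circuitP i0 star_gt0 (fun t => relu (tent_form N t x)) i.
rewrite -/(tent x i) in vE vm; apply/eqP; rewrite eq_le; apply/andP; split.
  rewrite vE; have [_ mk] := mP k.
  have [TT_T pT] := simplex_atP (Tagged (fun i => 'I_(s i)) k).
  have [_ Vd _ _] := frame.1 _ TT_T.
  have [q qT qu] := steep TT_T TT_T' pT T'x.
  have jd : (index q (V (simplex_at (Tagged (fun i => 'I_(s i)) k))) < d.+1)%N.
    by rewrite -Vd index_mem.
  apply: le_trans (mk (Ordinal jd)) _.
  by rewrite /relu ge_max u0 /tent_form /= nth_index.
case: (boolP (p i \in V T')) => pT'; last first.
  rewrite /u (negPf pT') vE; have [[j ->] _] := mP k.
  by rewrite /relu le_max lexx.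
have T's : (index T' (star i) < s i)%N by rewrite index_mem starP TT_T'.
apply: le_trans (vm (Ordinal T's)); have [[j ->] _] := mP (Ordinal T's).
rewrite /relu le_max; apply/orP; right.
rewrite /tent_form /u pT' /simplex_at /= nth_index ?starP ?TT_T' // lerDl.
case: ifP => // _; apply: mulr_ge0 => //; apply: b'0; apply: mem_nth.
by have [_ -> _ _] := frame.1 _ TT_T'.
Qed.

Lemma tent_continuous i : continuous (fun x => tent x i : R^o).
Proof.
apply: maxmin_circuit_continuous => t x.
have fc := @affine_continuous _ _ _ (tent_form_affine N t) x.
apply: (@continuous_max _ _ (fun=> 0) (tent_form N t)) => //.
exact: cst_continuous.
Qed.

Lemma tent_CPwL i : CPwL TT Omega (fun x => tent x i).
Proof.
split; first exact/continuous_subspaceT/tent_continuous.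
move=> T TT_T; have [_ _ _ [ba _ _]] := frame.1 _ TT_T.
case: (boolP (p i \in V T)) => pT.
  have [a [c aE]] := ba (p i); exists a, c => x Tx.
  by rewrite -aE (tent_hat _ TT_T) ?pT //; exact: subset_closure.
exists 0, 0 => x Tx; rewrite mul0mx mxE addr0 (tent_hat _ TT_T) ?(negPf pT) //.
exact: subset_closure.
Qed.

Lemma tent_vertex i q : vertices TT q -> tent q i = (p i == q)%:R.
Proof.
move=> /vertices_frame[T TT_T qT]; have [Vi _ _ bV] := frame.1 _ TT_T.
rewrite (tent_hat _ TT_T); last by rewrite closure_simplex //; exact: mem_hull.
case: ifP => [pT|]; first by rewrite (barycentric_vertex Vi bV).
by case: eqVneq => // ->; rewrite qT.
Qed.

(** The hat function is chosen among all functions with its defining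
  properties; the tent is one of them, and they are all equal on the domain. *)
Lemma hat_tent i : hat TT Omega (p i) = restr Omega (fun x => tent x i).
Proof.
rewrite /hat; case: xgetP => [f _ [w [wP w1 w0] <-]|none].
  apply/funext => x; apply: (CPwL_eq wP (tent_CPwL i)).
    move=> q qv; rewrite tent_vertex //; case: eqVneq => [<-|/eqP piq] //.
    by rewrite w0 // => /esym.
  by apply: subset_closure; exact: set_valP.
exfalso; apply: (none (restr Omega (fun x => tent x i))).
exists (fun x => tent x i) => //; split; first exact: tent_CPwL.
  by rewrite tent_vertex ?eqxx //; exact: p_vertex.
by move=> q qv /eqP; rewrite tent_vertex // eq_sym => /negPf ->.
Qed.

End Tent.
End Tents.
End Frame.
End Mesh.

(** * Linear algebra *)

Section Dimension.
Variables (R : realType) (V : lmodType R) (S : set V).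

(** The matrices that express either basis in the other one are inverse to each
  other by uniqueness of coordinates. *)
Lemma basis_size_le n m (b : 'I_n -> V) (b' : 'I_m -> V) :
  is_basis S b -> is_basis S b' -> (n <= m)%N.
Proof.
move=> [bS bU] [bS' bU'].
have /choice[A AE] : forall i, exists c : {ffun 'I_m -> R},
    b i = \sum_j c j *: b' j.
  by move=> i; have [c [cE _]] := bU' _ (bS i); exists c.
have /choice[B BE] : forall j, exists c : {ffun 'I_n -> R},
    b' j = \sum_i c i *: b i.
  by move=> j; have [c [cE _]] := bU _ (bS' j); exists c.
apply: (@mulmx1_min _ _ _ (\matrix_(i, j) A i j) (\matrix_(j, i) B j i)).
apply/matrixP => i k; rewrite !mxE.
have [c [_ cU]] := bU _ (bS i).
have h1 : c = [ffun l => (i == l)%:R].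
  apply: cU; rewrite (bigD1 i) //= ffunE eqxx scale1r big1 ?addr0 // => l li.
  by rewrite ffunE eq_sym (negPf li) scale0r.
have h2 : c = [ffun l => \sum_j A i j * B j l].
  apply: cU; rewrite [LHS]AE; under eq_bigr do rewrite BE scaler_sumr.
  rewrite exchange_big /=; apply: eq_bigr => l _; rewrite ffunE scaler_suml.
  by apply: eq_bigr => j _; rewrite scalerA.
have := congr1 (fun c : {ffun _} => c k) h2; rewrite h1 !ffunE => ->.
by apply: eq_bigr => j _; rewrite !mxE.
Qed.

Lemma subspace_dim_basis n (b : 'I_n -> V) :
  is_basis S b -> subspace_dim S = n.
Proof.
move=> bB; rewrite /subspace_dim; case: xgetP => [m _ [b' bB']|/(_ n)[]].
  by apply/eqP; rewrite eqn_leq (basis_size_le bB' bB) (basis_size_le bB bB').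
by exists b.
Qed.

End Dimension.

Section Transport.
Variables (R : realType) (T : Type) (F : lmodType R) (S : set F).
Variables (f : T -> F) (g : F -> T).
Hypotheses (fS : forall t, S (f t)) (fK : forall t, g (f t) = t).
Hypotheses (gK : forall v, S v -> f (g v) = v).
Hypotheses (S0 : S 0) (SZD : forall a u v, S u -> S v -> S (a *: u + v)).

(** [T] with the linear operations of [S], which [f] identifies with [T].  The
  alias keeps the structures below from applying to [T] itself. *)
Definition transported : Type := T.
Notation T' := transported.

Let SD u v : S u -> S v -> S (u + v).
Proof. by rewrite -{2}[u]scale1r; exact: SZD. Qed.
Let SZ a u : S u -> S (a *: u).
Proof. by move=> Su; rewrite -[_ *: _]addr0; exact: SZD. Qed.
Let SN u : S u -> S (- u).
Proof. by rewrite -scaleN1r; exact: SZ. Qed.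

Let add (t u : T') : T' := g (f t + f u).
Let zero : T' := g 0.
Let opp (t : T') : T' := g (- f t).
Let scale (a : R) (t : T') : T' := g (a *: f t).

Let f_add t u : f (add t u) = f t + f u.
Proof. by rewrite gK //; exact: SD. Qed.
Let f_opp t : f (opp t) = - f t.
Proof. by rewrite gK //; exact: SN. Qed.
Let f_scale a t : f (scale a t) = a *: f t.
Proof. by rewrite gK //; exact: SZ. Qed.
Let f_inj : injective f.
Proof. exact: can_inj fK. Qed.

HB.instance Definition _ := gen_eqMixin T'.
HB.instance Definition _ := gen_choiceMixin T'.

Fact transported_addA : associative add.
Proof. by move=> t u v; apply: f_inj; rewrite !f_add addrA. Qed.
Fact transported_addC : commutative add.
Proof. by move=> t u; apply: f_inj; rewrite !f_add addrC. Qed.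
Fact transported_add0 : left_id zero add.
Proof. by move=> t; apply: f_inj; rewrite f_add gK // add0r. Qed.
Fact transported_addN : left_inverse zero opp add.
Proof. by move=> t; apply: f_inj; rewrite f_add f_opp addNr gK. Qed.

HB.instance Definition _ := GRing.isZmodule.Build T'
  transported_addA transported_addC transported_add0 transported_addN.

Fact transported_scaleA a c (t : T') : scale a (scale c t) = scale (a * c) t.
Proof. by apply: f_inj; rewrite !f_scale scalerA. Qed.
Fact transported_scale1 : left_id 1 scale.
Proof. by move=> t; apply: f_inj; rewrite f_scale scale1r. Qed.
Fact transported_scaleDr : right_distributive scale +%R.
Proof. by move=> a t u; apply: f_inj; rewrite !(f_add, f_scale) scalerDr. Qed.
Fact transported_scaleDl (t : T') : {morph scale^~ t : a c / a + c}.
Proof. by move=> a c; apply: f_inj; rewrite !(f_add, f_scale) scalerDl. Qed.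

HB.instance Definition _ := GRing.Zmodule_isLmodule.Build R T'
  transported_scaleA transported_scale1 transported_scaleDr
  transported_scaleDl.

Lemma transported_lmodule : exists cls : GRing.Lmodule.axioms_ R T,
  let W : lmodType R := GRing.Lmodule.Pack cls in
  linear (f : W -> F).
Proof.
exists (GRing.Lmodule.class (T' : lmodType R)) => /= a t u.
by rewrite f_add f_scale.
Qed.

End Transport.

Section NetworkSpace.
Variables (R : realType) (N : Type) (F : lmodType R) (S : set F).
Variables (Rz : N -> F) (Psi : F -> N).
Hypotheses (PsiK : forall v, S v -> Rz (Psi v) = v).
Hypotheses (S0 : S 0) (SZD : forall a u v, S u -> S v -> S (a *: u + v)).

(** [Psi] is a bijection from [S] to its image, with inverse [Rz]. *)
Lemma network_space : let NN : set N := Psi @` S in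
  exists NN_lmod : GRing.Lmodule.axioms_ R (set_type NN),
  let V : lmodType R := GRing.Lmodule.Pack NN_lmod in
  let RV (a : V) : F := Rz (val (a : set_type NN)) in
  [/\ forall (v w : F) (lambda : R) (a b : V),
        S v -> S w ->
        val (a : set_type NN) = Psi v -> val (b : set_type NN) = Psi w ->
        val (a + lambda *: b : set_type NN) = Psi (v + lambda *: w),
      linear RV
    & set_bij [set: V] S RV].
Proof.
move=> NN.
have NNP (t : set_type NN) : exists2 v, S v & val t = Psi v.
  by have /= [v Sv <-] := set_valP t; exists v.
pose f (t : set_type NN) : F := Rz (val t).
have inNN v : S v -> Psi v \in NN by move=> Sv; rewrite inE; exists v.
pose g (v : F) : set_type NN := insubd (SigSub (inNN 0 S0)) (Psi v).
have gE v : S v -> val (g v) = Psi v by move=> Sv; rewrite val_insubd inNN.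
have fS t : S (f t) by rewrite /f; have [v Sv ->] := NNP t; rewrite PsiK.
have fK t : g (f t) = t.
  apply: val_inj; rewrite gE // /f; have [v Sv ->] := NNP t.
  by rewrite PsiK.
have gK v : S v -> f (g v) = v by move=> Sv; rewrite /f gE // PsiK.
have [cls lin] := transported_lmodule fS fK gK S0 SZD.
exists cls => V RV; split=> //.
- move=> v w la a b Sv Sw aE bE.
  have Sab : S (v + la *: w) by rewrite addrC; exact: SZD.
  rewrite -gE //; congr val.
  rewrite -[LHS](fK (a + la *: b)) addrC lin addrC /f.
  by rewrite aE bE !PsiK.
- split=> [t _|t u _ _ ftu|v Sv]; first exact: fS.
    by rewrite -(fK t) -(fK u); congr g.
  by exists (g v) => //; exact: gK.
Qed.

End NetworkSpace.

(** * The finite element space *)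

Section FiniteElementSpace.
Variables (R : realType) (d : nat).
Notation point := 'cV[R]_d.
Variables (Omega : set point) (TT : {fset set point}).

Lemma CPwL_0 : CPwL TT Omega (fun=> 0).
Proof.
split; first exact/continuous_subspaceT/cst_continuous.
by move=> T _; exists 0, 0 => x _; rewrite mul0mx mxE addr0.
Qed.

Lemma CPwL_ZD a w w' : CPwL TT Omega w -> CPwL TT Omega w' ->
  CPwL TT Omega (fun x => a * w x + w' x).
Proof.
move=> [wc waff] [wc' waff']; split.
  move=> x; apply: (@cvgD _ R^o); last exact: wc'.
  by apply: cvgM; [exact: cvg_cst|exact: wc].
move=> T TT_T; have [r [c wE]] := waff T TT_T.
have [r' [c' wE']] := waff' T TT_T.
exists (a *: r + r'), (a * c + c') => x Tx.
by rewrite wE // wE' // mulmxDl -scalemxAl !mxE; ring.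
Qed.

Lemma CPwL_sum n (c : 'I_n -> R) (w : 'I_n -> point -> R) :
  (forall i, CPwL TT Omega (w i)) ->
  CPwL TT Omega (fun x => \sum_i c i * w i x).
Proof.
move=> wP; elim: (index_enum _) => [|i r IH].
  rewrite (_ : (fun _ => _) = fun=> 0); first exact: CPwL_0.
  by apply/funext => x; rewrite big_nil.
rewrite (_ : (fun _ => _) = fun x => c i * w i x + \sum_(j <- r) c j * w j x).
  exact: CPwL_ZD.
by apply/funext => x; rewrite big_cons.
Qed.

Lemma S11_0 : S11 TT Omega 0.
Proof. by exists (fun=> 0); [exact: CPwL_0|apply/funext]. Qed.

Lemma S11_ZD a u v : S11 TT Omega u -> S11 TT Omega v ->
  S11 TT Omega (a *: u + v).
Proof.
move=> [w wP <-] [w' wP' <-]; exists (fun x => a * w x + w' x) => //.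
exact: CPwL_ZD.
Qed.

Lemma restr_sum n (c : 'I_n -> R) (w : 'I_n -> point -> R) :
  \sum_i c i *: restr Omega (w i) = restr Omega (fun x => \sum_i c i * w i x).
Proof. by apply/funext => x; rewrite fct_sumE. Qed.

(** The coefficients are the vertex values: a function of the space is determined
  by them, and they are determined by its restriction to the domain, because
  the domain is dense in its closure. *)
Lemma S11_nodal_basis V b n (p : 'I_n -> point) (w : 'I_n -> point -> R) :
  regular_triangulation TT Omega -> mesh_frame TT V b ->
  range p = vertices TT -> (forall i, CPwL TT Omega (w i)) ->
  (forall i j, w i (p j) = (i == j)%:R) ->
  is_basis (S11 TT Omega) (fun i => restr Omega (w i)).
Proof.
move=> reg frame pV wP wp; split=> [i|_ [v vP <-]]; first by exists (w i); [exact: wP|].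
have sum_w (c : 'I_n -> R) j : \sum_i c i * w i (p j) = c j.
  rewrite (bigD1 j) //= wp eqxx mulr1 big1 ?addr0 // => i /negPf ij.
  by rewrite wp ij mulr0.
exists [ffun i => v (p i)]; split.
  rewrite restr_sum; apply/funext => x.
  apply: (CPwL_eq reg frame vP (CPwL_sum _ wP)).
    by rewrite -pV => _ [j _ <-]; rewrite sum_w ffunE.
  by apply: subset_closure; exact: set_valP.
move=> c; rewrite restr_sum => vE; apply/ffunP => j; rewrite ffunE.
have cP := CPwL_sum c wP; rewrite -[RHS](sum_w c).
have pj : closure Omega (p j).
  have /(vertices_frame frame)[T TT_T pT] : vertices TT (p j) by rewrite -pV; exists j.
  apply: (simplex_closure reg TT_T).
  by rewrite (closure_simplex frame) //; exact: mem_hull.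
apply: (eq_within_closure (A := Omega) vP.1 cP.1 _ _ pj pj).
  exact: subset_closure.
by move=> y Oy; have := congr1 (fun f => f (SigSub (mem_set Oy))) vE.
Qed.

End FiniteElementSpace.

(** * Depth and size bounds *)

Lemma up_log2_le_log2 (R : realType) (m : nat) : (0 < m)%N ->
  (up_log 2 m)%:R <= log2 m%:R + 1 :> R.
Proof.
case: m => [//|[_|m _]]; first by rewrite /log2 ln1 mul0r add0r up_log1.
have l2 : 0 < ln 2 :> R by rewrite ln_gt0 // ltr1n.
have /(up_log_gtn (isT : (1 < 2)%N)) := isT : (1 < m.+2)%N.
set k := up_log 2 m.+2; have k0 : (0 < k)%N by rewrite up_log_gt0.
move=> lt_m; rewrite -(prednK k0) -natr1 lerD2r /log2 ler_pdivlMr //.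
rewrite mulr_natl -lnXn ?ltr0n // ler_ln ?posrE ?exprn_gt0 ?ltr0n //.
by rewrite -natrX ler_nat ltnW.
Qed.

Lemma log2_le (R : realType) (m : nat) : log2 m%:R <= m%:R :> R.
Proof.
have l2 : 0 < ln 2 :> R by rewrite ln_gt0 // ltr1n.
case: m => [|m]; first by rewrite /log2 ln0 ?mul0r.
rewrite /log2 ler_pdivrMr // mulr_natl -lnXn ?ltr0n //.
rewrite ler_ln ?posrE ?exprn_gt0 ?ltr0n // -natrX ler_nat.
by rewrite ltnW // ltn_expl.
Qed.

Lemma log2_ge0 (R : realType) (m : nat) : (0 < m)%N -> 0 <= log2 m%:R :> R.
Proof.
by move=> m0; rewrite /log2 divr_ge0 // ln_ge0 // ler1n.
Qed.

(** For [d >= 2] the polynomial in [d] of the entry count, plus [8] for rounding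
  up the logarithm, is at most [20 * d ^ 2]. *)
Lemma size_bound_real (R : realType) (d n S m : nat) : (2 <= d)%N ->
  (0 < m)%N -> (n <= S)%N ->
  (S * (d.+1 ^ 2 + 16 * d.+1 + 10) + 8 * n * up_log 2 m)%N%:R <=
  20 * n%:R * log2 m%:R + 20 * d%:R ^+ 2 * S%:R :> R.
Proof.
move=> d2 m0 nS; have := up_log2_le_log2 R m0; have := log2_ge0 R m0.
have : 2 <= d%:R :> R by rewrite ler_nat.
have : n%:R <= S%:R :> R by rewrite ler_nat.
have dE : d.+1%:R = d%:R + 1 :> R by rewrite natr1.
rewrite natrD !(natrM, natrD, natrX).
have : 0 <= n%:R :> R by [].
set x := d%:R; set N := n%:R; set SS := S%:R; set l := log2 _.
set k := (up_log _ _)%:R.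
move=> N0 NS x2 l0 kl.
have h1 : N * k <= N * l + SS by nra.
have h2 : SS * ((x + 1) ^+ 2 + 16 * (x + 1) + 18) <= SS * (20 * x ^+ 2).
  by apply: ler_wpM2l; nra.
by nra.
Qed.

Lemma size_bounds_le (R : realType) (d n S m : nat) : (2 <= d)%N ->
  (S <= n * m)%N ->
  20 * n%:R * log2 m%:R + 20 * d%:R ^+ 2 * S%:R <=
  40 * d%:R ^+ 2 * m%:R * n%:R :> R.
Proof.
move=> d2; have : 2 <= d%:R :> R by rewrite ler_nat.
rewrite -(ler_nat R) natrM; have := log2_le R m.
have : 0 <= n%:R :> R by []. have : 0 <= m%:R :> R by [].
set x := d%:R; set N := n%:R; set SS := S%:R; set M := m%:R; set l := log2 _.
move=> M0 N0 lM x2 SM.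
have h0 : 1 <= x ^+ 2 by nra.
have h1 : N * l <= N * M by rewrite ler_wpM2l.
have h2 : N * M <= x ^+ 2 * (N * M) by rewrite ler_peMl // mulr_ge0.
have h3 : x ^+ 2 * SS <= x ^+ 2 * (N * M).
  by rewrite ler_wpM2l // ltW // (lt_le_trans _ h0).
lra.
Qed.

(** * Emulation of the finite element space *)

Theorem proposition5p7 (R : realType) :
  exists (C C' : R)
    (archP archV : nat -> nat -> seq nat -> seq nat * seq (seq (R -> R))),
  [/\ 0 < C, 0 < C' &
  forall (d : nat) (Omega : set 'cV[R]_d) (TT : {fset set 'cV[R]_d})
    (n : nat) (p : 'I_n -> 'cV[R]_d),
  (2 <= d)%N ->
  bounded_polytopal_domain Omega ->
  regular_triangulation TT Omega ->
  injective p -> range p = vertices TT ->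
  let s (i : 'I_n) : nat := nb_simplices TT (p i) in
  let smax : nat := (\max_(i < n) s i)%N in
  let smultiset : seq nat := sort leq [seq s i | i <- enum 'I_n] in
  let SS : set (Omega -> R^o) := S11 TT Omega in
  let theta (i : 'I_n) : Omega -> R^o := hat TT Omega (p i) in
  let depth_bound : R := 8 + log2 smax%:R + log2 d.+1%:R in
  let size_bound : R :=
    C * n%:R * log2 smax%:R + C * d%:R ^+ 2 * (\sum_(i < n) s i)%N%:R in
  let size_bound' : R := C' * d%:R ^+ 2 * smax%:R * (subspace_dim SS)%:R in
  exists (Phi : nn R d n) (Psi : (Omega -> R^o) -> nn R d 1),
  let NN : set (nn R d 1) := Psi @` SS in
  let Rz (Theta : nn R d 1) : Omega -> R^o :=
    fun x => realization Theta (val x) 0 0 in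
  [/\ (* (i) *)
      [/\ only_relu Phi,
          forall (x : Omega) (i : 'I_n),
            realization Phi (val x) i 0 = theta i x,
          (depth Phi)%:R <= depth_bound
        & (nn_size Phi)%:R <= size_bound /\ size_bound <= size_bound'],
      (* (ii) *)
      forall v, SS v ->
      [/\ only_relu (Psi v),
          forall x : Omega, realization (Psi v) (val x) 0 0 = v x,
          (depth (Psi v))%:R <= depth_bound
        & (nn_size (Psi v))%:R <= size_bound /\ size_bound <= size_bound'],
      (* (iii) *)
      [/\ architecture Phi = archP d n smultiset,
          forall v, SS v -> architecture (Psi v) = archV d n smultiset
        & n = subspace_dim SS /\ is_basis SS theta]
    & (* (iv) *)
      exists NN_lmod : GRing.Lmodule.axioms_ R (set_type NN),
      let V : lmodType R := GRing.Lmodule.Pack NN_lmod in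
      let RV (a : V) : Omega -> R^o := Rz (val (a : set_type NN)) in
      [/\ forall (v w : Omega -> R^o) (lambda : R) (a b : V),
            SS v -> SS w ->
            val (a : set_type NN) = Psi v -> val (b : set_type NN) = Psi w ->
            val (a + lambda *: b : set_type NN) = Psi (v + lambda *: w),
          linear RV
        & set_bij [set: V] SS RV]]].
Proof.
exists 20, 40, (fun d n ms => relu_architecture R (hidden_dims d ms) n),
  (fun d n ms => relu_architecture R (hidden_dims d ms) 1).
split=> // d Omega TT n p d2 [_ _ [x0 Ox0] _ _] reg p_inj pV.
move=> s smx smultiset SS theta depth_bound size_bound size_bound'.
have [V [b frame]] := mesh_frame_exists reg.
have [N N0 steep] := steep_enough_exists frame p.
(* a nonempty domain has a simplex and hence a vertex, so that the index types
   of the circuits are inhabited *)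
have [i0 _] : exists i0 : 'I_n, True.
  have /(closure_cover reg)[T TT_T _] : closure Omega x0 by exact: subset_closure.
  have [_ Vd _ _] := frame.1 _ TT_T.
  have /fset0Pn[q qT] : V T != fset0 by rewrite -cardfs_gt0 Vd.
  have : vertices TT q by apply/(vertices_frame frame); exists T.
  by rewrite -pV => -[i0 _ _]; exists i0.
have n_gt0 : (0 < n)%N by apply: leq_ltn_trans (ltn_ord i0).
pose w i x := tent frame pV N i0 x i.
have wP i : CPwL TT Omega (w i) by exact: tent_CPwL.
have thetaE i : theta i = restr Omega (w i) by exact: hat_tent.
have wp i j : w i (p j) = (i == j)%:R.
  by rewrite /w tent_vertex ?(inj_eq p_inj) //; exact: p_vertex.
have basis : is_basis SS theta.
  rewrite (_ : theta = fun i => restr Omega (w i)); last exact/funext.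
  exact: (S11_nodal_basis reg frame pV wP wp).
have dimE : subspace_dim SS = n by exact: subspace_dim_basis basis.
pose s0 : forall i, (0 < s i)%N := star_gt0 frame pV.
have smx0 : (0 < smx)%N by apply: leq_trans (s0 i0) (leq_bigmax i0).
have nS : (n <= \sum_(i < n) s i)%N.
  by rewrite -{1}[n]card_ord -sum1_card; apply: leq_sum => i _; exact: s0.
have [a aP] := choice (tent_form_affine frame pV N).
have [c acE] := choice aP.
pose net q (q0 : (0 < q)%N) B : nn R d q := maxmin_net i0 s0 a c q0 B.
have netE q (q0 : (0 < q)%N) B x :
    realization (net q q0 B) x = B *m vec (fun i => w i x).
  rewrite realization_maxmin_net; congr (_ *m vec _).
  rewrite /maxmin /w /tent; apply/funext => i; congr (run _ _ i).
  by apply/funext => t; rewrite acE.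
have archE q (q0 : (0 < q)%N) B : architecture (net q q0 B) =
    relu_architecture R (hidden_dims d smultiset) q.
  rewrite architecture_maxmin_net (@perm_hidden_dims d _ smultiset) //.
  by rewrite perm_sym perm_sort.
have depth_le q (q0 : (0 < q)%N) B : (depth (net q q0 B))%:R <= depth_bound.
  rewrite depth_maxmin_net !natrD /depth_bound.
  have := up_log2_le_log2 R smx0; have := up_log2_le_log2 R (ltn0Sn d).
  by rewrite -/smx; lra.
have size_le q (q0 : (0 < q)%N) B : (norm0 B <= n)%N ->
    (nn_size (net q q0 B))%:R <= size_bound.
  move=> Bn; apply: le_trans (size_bound_real R d2 smx0 nS).
  by rewrite ler_nat; exact: size_maxmin_net.
have bound_le : size_bound <= size_bound'.
  rewrite /size_bound /size_bound' dimE; apply: size_bounds_le => //.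
  apply: leq_trans (_ : \sum_(i < n) smx <= _)%N.
    by apply: leq_sum => i _; exact: leq_bigmax.
  by rewrite sum_nat_const card_ord.
pose B1 : 'M[R]_(n, #|'I_n|) := \matrix_(i, k) (enum_val k == i)%:R.
have B1n : (norm0 B1 <= n)%N.
  rewrite -[leqRHS]muln1; apply: norm0_row_sparse => i.
  apply: leq_trans (_ : #|[set enum_rank i]%SET| <= 1)%N; last by rewrite cards1.
  apply: subset_leq_card; apply/fintype.subsetP => k; rewrite !inE mxE.
  apply: contraR => ki; rewrite (_ : _ == i = false) //; apply: contraNF ki.
  by move=> /eqP <-; rewrite enum_valK.
have /choice[coord coordE] : forall v, exists c : {ffun 'I_n -> R}, SS v ->
    v = \sum_i c i *: theta i.
  move=> v; have [/basis.2[k [kE _]]|nv] := pselect (SS v); first by exists k.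
  by exists [ffun=> 0].
pose Brow v : 'M[R]_(1, #|'I_n|) := \matrix_(_, k) coord v (enum_val k).
have Brown v : (norm0 (Brow v) <= n)%N.
  by apply: leq_trans (norm0_le_mul _) _; rewrite mul1n card_ord.
have PsiE v : SS v -> forall x : Omega,
    realization (net 1%N isT (Brow v)) (val x) 0 0 = v x.
  move=> Sv x; rewrite (netE 1%N isT (Brow v) (val x)) [in RHS](coordE v Sv).
  rewrite (mulmx_enum_vec (fun _ => coord v)) fct_sumE; apply: eq_bigr => i _.
  by rewrite thetaE.
exists (net n n_gt0 B1), (fun v => net 1%N isT (Brow v)); split.
- split=> [|x i||]; [exact: only_relu_maxmin_net| |exact: depth_le|].
    rewrite netE (mulmx_enum_vec (fun i k => (k == i)%:R)) sum_delta.
    by rewrite thetaE.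
  by split=> //; exact: size_le.
- move=> v Sv; split; [exact: only_relu_maxmin_net|exact: PsiE|exact: depth_le|].
  by split=> //; exact: size_le.
- by split=> [|v _|]; rewrite ?archE.
- apply: (network_space (Rz := fun Theta (x : Omega) => realization Theta (val x) 0 0)).
  + by move=> v Sv; apply/funext => x; exact: PsiE.
  + exact: S11_0.
  + by move=> k u v; exact: S11_ZD.
Qed.
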